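(* Let $X,U$ be Banach spaces, let $A$ generate a $C_0$-semigroup $(T(t))_{t\ge 0}$ on $X$, and let $B:U\to X_{-1}$ be linear and bounded. The following statements are equivalent. (i) $\Sigma(A,B)$ is $L^1$-ISS. (ii) $\Sigma(A,B)$ is $L^1$-iISS. (iii) $\Sigma(A,B)$ is $E_\Phi$-ISS for every Young function $\Phi$.
   Context: System. $X_{-1}$ is the completion of $X$ with respect to $\|x\|_{X_{-1}}=\|(\beta-A)^{-1}x\|_X$ for some $\beta\in\rho(A)$; $(T(t))_{t\ge0}$ extends uniquely to a $C_0$-semigroup $(T_{-1}(t))_{t\ge0}$ on $X_{-1}$, whose generator $A_{-1}$ extends $A$. $\Sigma(A,B)$ denotes the system $\dot x(t)=Ax(t)+Bu(t)$, $x(0)=x_0$, $t\ge 0$. Its mild solution for $x_0\in X$ and input $u$ is $x(t)=T(t)x_0+\int_0^tT_{-1}(t-s)Bu(s)\,ds$, which in general is an element of $X_{-1}$. $\|\cdot\|$ without index is the norm of $X$. Comparison functions ($\mathbb R_0^+=[0,\infty)$). $\mathcal K$: functions $\mu:\mathbb R_0^+\to\mathbb R_0^+$ that are continuous, strictly increasing, with $\mu(0)=0$. $\mathcal K_\infty$: $\theta\in\mathcal K$ with $\lim_{x\to\infty}\theta(x)=\infty$. $\mathcal L$: continuous strictly decreasing $\gamma:\mathbb R_0^+\to\mathbb R_0^+$ with $\lim_{t\to\infty}\gamma(t)=0$. $\mathcal{KL}$: $\beta:(\mathbb R_0^+)^2\to\mathbb R_0^+$ with $\beta(\cdot,t)\in\mathcal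 K$ for all $t\ge0$ and $\beta(s,\cdot)\in\mathcal L$ for all $s>0$. Stability notions. Let $Z$ stand for $L^1$ or $E_\Phi$, with $Z(0,t;U)=L^1(0,t;U)$ or $E_\Phi(0,t;U)$ respectively. In each of the following, the stated property is to hold for every $t\ge0$, $x_0\in X$, $u\in Z(0,t;U)$. - $Z$-ISS: there are $\beta\in\mathcal{KL}$, $\mu\in\mathcal K_\infty$ such that $x(t)\in X$ and $\|x(t)\|\le\beta(\|x_0\|,t)+\mu(\|u\|_{Z(0,t;U)})$. - $Z$-iISS: there are $\beta\in\mathcal{KL}$, $\theta\in\mathcal K_\infty$, $\mu\in\mathcal K$ such that $x(t)\in X$ and $\|x(t)\|\le\beta(\|x_0\|,t)+\theta\left(\int_0^t\mu(\|u(s)\|_U)\,ds\right)$ (regarded as trivially satisfied if the integral is infinite). Orlicz spaces. A Young function is $\Phi:[0,\infty)\to\mathbb R$, $\Phi(t)=\int_0^t\varphi(s)\,ds$, where $\varphi:[0,\infty)\to\mathbb R$ is right-continuous and nondecreasing, $\varphi(0)=0$, $\varphi(s)>0$ for $s>0$, and $\lim_{s\to\infty}\varphi(s)=\infty$. For a bounded open interval $I$, $L_\Phi(I;U)$ is the space of (classes of) Bochner-measurable $u:I\to U$ for which $\int_I\Phi(k^{-1}\|u(x)\|_U)\,dx<\infty$ for some $k>0$, with the Luxemburg norm $\|u\|_\Phi=\inf\{k>0:\int_I\Phi(k^{-1}\|u(x)\|_U)\,dx\le1\}$. $E_\Phi(I;U)$ is the closure of $L^\infty(I;U)$ in $L_\Phi(I;U)$,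 with the same norm. *)

(* Defs.v *)
From HB Require Import structures.
From mathcomp Require Import all_boot all_order all_algebra.
From mathcomp Require Import all_classical all_reals all_analysis.

Set Implicit Arguments.
Unset Strict Implicit.
Unset Printing Implicit Defensive.

Import Order.TTheory GRing.Theory Num.Theory.
Import numFieldNormedType.Exports.

Local Open Scope classical_set_scope.
Local Open Scope ring_scope.

(* Scalars are real.  A complex Banach space is covered by restriction of
   scalars: semigroup, generator, boundedness and Bochner integrals are the
   same over R and over C, the resolvent set of a generator contains a real
   half-line, and the choice of beta only changes the norm of X_{-1} to an
   equivalent one.

   Functions on [0, +oo[ are total functions R -> R whose values at negative
   arguments are never used. *)

Section comparison_functions.
Context {R : realType}.
Implicit Types (mu theta gamma : R -> R) (beta : R -> R -> R).

Definition class_K mu : Prop :=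
  [/\ forall x, 0 <= x -> 0 <= mu x,
      {within `[0, +oo[, continuous mu},
      {in `[0, +oo[ &, {homo mu : x y / x < y}} &
      mu 0 = 0].

Definition class_Kinfty theta : Prop :=
  class_K theta /\ theta x @[x --> +oo] --> +oo.

Definition class_L gamma : Prop :=
  [/\ forall t, 0 <= t -> 0 <= gamma t,
      {within `[0, +oo[, continuous gamma},
      {in `[0, +oo[ &, {homo gamma : s t /~ s < t}} &
      gamma t @[t --> +oo] --> 0].

Definition class_KL beta : Prop :=
  (forall t, 0 <= t -> class_K (beta ^~ t)) /\
  (forall s, 0 < s -> class_L (beta s)).

Definition young_function (Phi : R -> R) : Prop :=
  exists phi : R -> R,
    [/\ forall s, 0 <= s -> phi x @[x --> s^'+] --> phi s,
        {in `[0, +oo[ &, {homo phi : x y / x <= y}},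
        phi 0 = 0 /\ (forall s, 0 < s -> 0 < phi s),
        phi s @[s --> +oo] --> +oo &
        forall t, 0 <= t -> Phi t = \int[lebesgue_measure]_(s in `[0, t]) phi s].

End comparison_functions.

Section bochner.
Context {R : realType} {V : normedModType R}.
Implicit Types (D : set R) (f s : R -> V).
Local Notation mu := (@lebesgue_measure R).

Definition simple_fun s : Prop :=
  finite_set (range s) /\ forall v, measurable (s @^-1` [set v]).

Definition bochner_measurable D f : Prop :=
  exists2 s_ : nat -> R -> V,
    (forall n, simple_fun (s_ n)) &
    {ae mu, forall x, D x -> s_ n x @[n --> \oo] --> f x}.

(* Meant for D of finite measure, the only case used below: every simple
   function is then integrable on D. *)
Definition simple_integral D s : V :=
  \sum_(v \in range s) fine (mu (D `&` s @^-1` [set v])) *: v.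

Definition is_bochner_integral D f (v : V) : Prop :=
  bochner_measurable D f /\
  exists s_ : nat -> R -> V,
    [/\ forall n, simple_fun (s_ n),
        (\int[mu]_(x in D) `|f x - s_ n x|%:E)%E @[n --> \oo] --> 0%E &
        simple_integral D (s_ n) @[n --> \oo] --> v].

(* Junk value 0 when f is not Bochner integrable on D. *)
Definition bochner_integral D f : V := xget 0 [set v | is_bochner_integral D f v].

End bochner.

(* Classes of functions are represented by their members; an element of
   Z(0, t; U) is any function R -> U whose restriction to ]0, t[ is in the
   space. *)
Record input_space (R : realType) (U : normedModType R) := InputSpace {
  in_space : R -> set (R -> U) ;
  space_norm : R -> (R -> U) -> R
}.

Section input_spaces.
Context {R : realType} (U : normedModType R).
Implicit Types (D : set R) (u : R -> U) (Phi : R -> R).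
Local Notation mu := (@lebesgue_measure R).

Definition L1_mem D u : Prop :=
  bochner_measurable D u /\ (\int[mu]_(s in D) `|u s|%:E < +oo)%E.

Definition L1_norm D u : R := fine (\int[mu]_(s in D) `|u s|%:E)%E.

Definition Linfty_mem D u : Prop :=
  bochner_measurable D u /\
  exists M : R, {ae mu, forall s, D s -> `|u s| <= M}.

Definition orlicz_modular Phi D u (k : R) : \bar R :=
  (\int[mu]_(s in D) (Phi (k^-1 * `|u s|)%R)%:E)%E.

Definition LPhi_mem Phi D u : Prop :=
  bochner_measurable D u /\
  exists2 k : R, 0 < k & (orlicz_modular Phi D u k < +oo)%E.

Definition luxemburg_norm Phi D u : R :=
  inf [set k : R | 0 < k /\ (orlicz_modular Phi D u k <= 1)%E].

Definition EPhi_mem Phi D u : Prop :=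
  LPhi_mem Phi D u /\
  forall e : R, 0 < e ->
    exists2 v : R -> U, Linfty_mem D v & luxemburg_norm Phi D (u \- v) < e.

Definition L1_space : input_space U :=
  InputSpace (fun t => L1_mem `]0, t[) (fun t => L1_norm `]0, t[).

Definition EPhi_space Phi : input_space U :=
  InputSpace (fun t => EPhi_mem Phi `]0, t[)
             (fun t => luxemburg_norm Phi `]0, t[).

End input_spaces.

Section semigroups.
Context {R : realType}.

(* T t is irrelevant for t < 0. *)
Definition C0_semigroup (X : normedModType R) (T : R -> {linear X -> X}) : Prop :=
  [/\ forall t, 0 <= t -> continuous (T t),
      forall x, T 0 x = x,
      forall s t, 0 <= s -> 0 <= t -> forall x, T (s + t) x = T s (T t x) &
      forall x, T t x @[t --> 0^'+] --> x].

(* The values of opval outside dom are irrelevant. *)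
Record operator (X : normedModType R) := Operator {
  dom : set X ;
  opval :> X -> X
}.

Definition generates (X : normedModType R) (A : operator X)
    (T : R -> {linear X -> X}) : Prop :=
  dom A = [set x | cvg (h^-1 *: (T h x - x) @[h --> 0^'+])] /\
  forall x, dom A x -> h^-1 *: (T h x - x) @[h --> 0^'+] --> A x.

(* b is in the resolvent set of A and Rb = (b - A)^-1. *)
Definition is_resolvent (X : normedModType R) (A : operator X) (b : R)
    (Rb : {linear X -> X}) : Prop :=
  [/\ continuous Rb,
      forall x, dom A (Rb x) /\ b *: Rb x - A (Rb x) = x &
      forall x, dom A x -> Rb (b *: x - A x) = x].

(* Y, with the embedding iota of X, is a completion of X for the norm
   |(b - A)^-1 x|: Y is complete, iota is isometric for that norm and has
   dense range.  This determines (Y, iota) up to isometric isomorphism. *)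
Definition extrapolation_space (X : normedModType R) (A : operator X)
    (Y : completeNormedModType R) (iota : {linear X -> Y}) : Prop :=
  dense (range iota) /\
  exists (b : R) (Rb : {linear X -> X}),
    is_resolvent A b Rb /\ forall x, `|iota x| = `|Rb x|.

(* Such an extension is unique on t >= 0, by density of the range of iota. *)
Definition extended_semigroup (X : normedModType R) (Y : normedModType R)
    (iota : {linear X -> Y}) (T : R -> {linear X -> X})
    (Tm1 : R -> {linear Y -> Y}) : Prop :=
  C0_semigroup Tm1 /\ forall t x, 0 <= t -> Tm1 t (iota x) = iota (T t x).

End semigroups.

Section stability.
Context {R : realType} {X Xm1 U : normedModType R}.
Variables (iota : {linear X -> Xm1}) (T : R -> {linear X -> X})
  (Tm1 : R -> {linear Xm1 -> Xm1}) (B : {linear U -> Xm1}).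

Definition mild_solution (x0 : X) (u : R -> U) (t : R) : Xm1 :=
  iota (T t x0) + bochner_integral `]0, t[ (fun s => Tm1 (t - s) (B (u s))).

Definition ISS (Z : input_space U) : Prop :=
  exists (beta : R -> R -> R) (mu : R -> R),
    [/\ class_KL beta, class_Kinfty mu &
        forall t x0 u, 0 <= t -> in_space Z t u ->
          exists2 x : X, iota x = mild_solution x0 u t &
            `|x| <= beta `|x0| t + mu (space_norm Z t u)].

(* Membership of the solution in X is required for every u in Z; only the
   estimate is void when the integral is infinite. *)
Definition iISS (Z : input_space U) : Prop :=
  exists (beta : R -> R -> R) (theta mu : R -> R),
    [/\ class_KL beta, class_Kinfty theta, class_K mu &
        forall t x0 u, 0 <= t -> in_space Z t u ->
          let I := (\int[lebesgue_measure]_(s in `]0%R, t[) (mu `|u s|%R)%:E)%E in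
          exists2 x : X, iota x = mild_solution x0 u t &
            (I < +oo)%E -> `|x| <= beta `|x0| t + theta (fine I)].

End stability.

(* Main.v *)
Require Import Defs.
From HB Require Import structures.
From mathcomp Require Import all_boot all_order all_algebra.
From mathcomp Require Import all_classical all_reals all_analysis.
From mathcomp Require Import measurable_realfun ring lra.

(* The implication from L^1-ISS to L^1-iISS is immediate, with the L^1-norm as
   the integral.

   From L^1-iISS to E_Phi-ISS: applied to u = 0 the hypothesis gives
   |T t x| <= beta 1 t |x|, so that T halves norms at some time tau, and applied
   to x0 = 0 it says that the input map Xi, with values in the extrapolation
   space, maps L^1(0, tau) into X.  Writing x = b Rb x - A (Rb x), the norm of X is
   controlled by the quotients n |T (1/n) (Rb x) - Rb x|, which are continuous for
   the norm of the extrapolation space; the uniform boundedness principle thus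
   makes Xi bounded from L^1(0, tau) to X.  Cutting [0, t] into pieces of length
   tau and summing a geometric series, |Xi u| is bounded by the largest L^1-norm
   of u on an interval of length at most tau, hence by its Luxemburg norm.

   From E_Phi-ISS for all Phi to L^1-ISS: otherwise there are simple inputs u_n
   with L^1-norm at most 1/(n+1) that reach states of norm n+1.  As each u_n is
   bounded, a Young function Phi growing slowly enough gives all of them Luxemburg
   norm at most 1, contradicting E_Phi-ISS. *)

Set Implicit Arguments.
Unset Strict Implicit.
Unset Printing Implicit Defensive.

Import Order.TTheory GRing.Theory Num.Theory.
Import numFieldNormedType.Exports.

Local Open Scope classical_set_scope.
Local Open Scope ring_scope.

(** * Finitely valued functions and their integrals *)

(** The integral in the iISS estimate may be infinite for an input in L^1, so no gain can be read
    off from it. What survives is that every L^1 input steers 0 into X, and linearity together with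
    completeness has to produce the bound. Inputs are functions rather than classes, so the uniform
    boundedness principle is run by hand, as a sliding hump made of simple functions; completeness
    of L^1 is then needed only along rapidly converging sequences. Comparing the L^1-norm with the
    Luxemburg norm on an interval costs a constant that grows with its length. This is why the
    estimate for large t looks only at windows of length tau: the gain must not depend on t. In the
    return to L^1-ISS, restricting to simple inputs makes each u_n bounded by some m_n. A Young
    function with Phi(s) at most (n+1)s on [0, m_n] suffices, because the factor n+1 is exactly
    compensated by the L^1-norm 1/(n+1). *)

Section sequences.
Context {R : realType}.

Lemma cvgn_normP (V : normedModType R) (u : nat -> V) (l : V) :
  u n @[n --> \oo] --> l <->
  forall e, 0 < e -> exists N, forall n, (N <= n)%N -> `|u n - l| < e.
Proof.
split=> [/cvgrPdist_lt ul e e0|ul].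
  by have [N _ hN] := ul e e0; exists N => n Nn; rewrite distrC; exact: hN.
apply/cvgrPdist_lt => e e0; have [N hN] := ul e e0.
by exists N => // n /= Nn; rewrite distrC; exact: hN.
Qed.

Lemma cauchy_cvgn (V : completeNormedModType R) (u : nat -> V) :
  (forall e, 0 < e -> exists N, forall n, (N <= n)%N -> `|u n - u N| < e) ->
  exists l : V, u n @[n --> \oo] --> l.
Proof.
move=> cu; apply/cvg_ex/cauchy_cvgP/cauchy_exP => e e0.
have [N hN] := cu e e0; exists (u N), N => // n /= Nn.
by rewrite -ball_normE /= distrC; exact: hN.
Qed.

Lemma invn_lt (e : R) : 0 < e -> exists k : nat, k.+1%:R^-1 < e.
Proof.
by move=> e0; exists (Num.truncn e^-1); rewrite invf_plt ?posrE// truncnS_gt.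
Qed.

End sequences.

Section finitely_valued.
Context {R : realType}.
Local Notation mu := (@lebesgue_measure R).

(** The codomain is an arbitrary type: a simple function can be paired with a boolean, a grid index
    or another simple function, and the pair then mapped into a normed space. *)
Definition finitely_valued (I : Type) (r : R -> I) : Prop :=
  finite_set (range r) /\ forall Y, measurable (r @^-1` Y).

Lemma finitely_valuedI (I : Type) (r : R -> I) :
  finite_set (range r) -> (forall i, measurable (r @^-1` [set i])) ->
  finitely_valued r.
Proof.
move=> fr mr; split=> // Y.
rewrite (_ : r @^-1` Y = \bigcup_(i in range r `&` Y) r @^-1` [set i]).
  apply: fin_bigcup_measurable => [|i _]; last exact: mr.
  exact: sub_finite_set fr.
apply/seteqP; split=> [x Yx|x [i [_ Yi]] /= ->//].
by exists (r x) => //; split => //; exists x.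
Qed.

Lemma simple_funP (V : normedModType R) (s : R -> V) :
  simple_fun s <-> finitely_valued s.
Proof.
by split=> [[]|[fs ms]]; [exact: finitely_valuedI|split=> // v; exact: ms].
Qed.

Lemma finitely_valued_comp (I J : Type) (r : R -> I) (F : I -> J) :
  finitely_valued r -> finitely_valued (F \o r).
Proof.
move=> [fr mr]; split=> [|Y]; last exact: (mr (F @^-1` Y)).
rewrite (_ : range (F \o r) = F @` range r); first exact: finite_image.
by rewrite image_comp.
Qed.

Lemma finitely_valued_pair (I J : Type) (r : R -> I) (q : R -> J) :
  finitely_valued r -> finitely_valued q ->
  finitely_valued (fun x => (r x, q x)).
Proof.
move=> [fr mr] [fq mq]; split=> [|Y].
  apply: (@sub_finite_set _ _ (range r `*` range q)); last exact: finite_setX.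
  by move=> _ [x _ <-]; split; exists x.
rewrite (_ : _ @^-1` Y =
  \bigcup_(i in range r) (r @^-1` [set i] `&` q @^-1` [set j | Y (i, j)])).
  by apply: fin_bigcup_measurable => // i _; apply: measurableI.
apply/seteqP; split=> [x Yx|x [i _] [/= -> //]].
by exists (r x) => //; exists x.
Qed.

Lemma finitely_valued_indicator (A : set R) :
  measurable A -> finitely_valued (fun x => x \in A).
Proof.
move=> mA; split=> [|Y]; first exact: finite_finset.
rewrite (_ : _ @^-1` Y = (A `&` [set _ | Y true]) `|` (~` A `&` [set _ | Y false])).
  have mc (P : Prop) : measurable [set _ : R | P].
    have [p|np] := pselect P.
      by rewrite (_ : mkset _ = setT)//; apply/seteqP; split.
    by rewrite (_ : mkset _ = set0)//; apply/seteqP; split.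
  by apply: measurableU; apply: measurableI => //; exact: measurableC.
apply/seteqP; split=> x /=.
  have [xA|xA] := pselect (A x); first by rewrite mem_set//; left.
  by rewrite memNset//; right.
by move=> [[Ax ?]|[nAx ?]]; [rewrite mem_set|rewrite memNset].
Qed.

Lemma simple_fun_map (I : Type) (V : normedModType R) (r : R -> I) (F : I -> V) :
  finitely_valued r -> simple_fun (F \o r).
Proof. by move=> fr; apply/simple_funP/finitely_valued_comp. Qed.

Lemma simple_fun_cst (V : normedModType R) (v : V) : simple_fun (fun _ => v).
Proof.
exact: (@simple_fun_map bool _ _ (fun _ => v) (finitely_valued_indicator measurableT)).
Qed.

Lemma simple_fun_lin (V : normedModType R) (a : R) (s s' : R -> V) :
  simple_fun s -> simple_fun s' -> simple_fun (fun x => a *: s x + s' x).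
Proof.
move=> /simple_funP fs /simple_funP fs'.
exact: (simple_fun_map (fun p => a *: p.1 + p.2) (finitely_valued_pair fs fs')).
Qed.

Lemma finitely_valued_measurable (I : Type) (r : R -> I) (F : I -> R) (D : set R) :
  finitely_valued r -> measurable_fun D (F \o r).
Proof.
by move=> [_ mr] mD Y mY; apply: measurableI => //; exact: (mr (F @^-1` Y)).
Qed.

Section integral.
Variables (D : set R) (mD : measurable D) (finD : (mu D < +oo)%E).

Let m (A : set R) : R := fine (mu (D `&` A)).

Let mu_fin (A : set R) : measurable A -> mu (D `&` A) \is a fin_num.
Proof.
move=> mA; rewrite ge0_fin_numE//; apply: le_lt_trans finD.
by apply: le_measure; rewrite ?inE//; exact: measurableI.
Qed.

Let m_preimage (I J : choiceType) (r : R -> I) (F : I -> J) (j : J) :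
  finitely_valued r ->
  m ((F \o r) @^-1` [set j]) =
  \sum_(i \in range r) (if F i == j then m (r @^-1` [set i]) else 0).
Proof.
move=> [fr mr].
under eq_fsbigr => i _ do rewrite -(asboolb (F i == j)) -/([set i | F i == j] i) -/(in_set _ _).
rewrite -fsbig_mkcondr.
have fr' : finite_set (range r `&` [set i | F i == j]) by exact: sub_finite_set fr.
apply: EFin_inj; rewrite -fsumEFin// fineK; last by apply: mu_fin; exact: (mr (F @^-1` [set j])).
rewrite [LHS](_ : _ =
    mu (\bigcup_(i in range r `&` [set i | F i == j]) (D `&` r @^-1` [set i]))).
  rewrite measure_fin_bigcup//.
  - by apply: eq_fsbigr => i _; rewrite fineK//; exact: mu_fin.
  - by move=> i k _ _ [x [[_ /= <-] [_ /= <-]]].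
  - by move=> i _; apply: measurableI => //; exact: mr.
congr (mu _); apply/seteqP; split=> [x [Dx /= Frx]|x [i [_ /= /eqP Fi] [Dx /= rx]]].
  by exists (r x) => //; split; [exists x|rewrite /= Frx].
by split => //=; rewrite rx.
Qed.

(** The sum may run over the fibres of any finitely valued map through which the function factors.
    For a linear combination that map is the pair of both functions, so all integrals become sums
    over the same fibres. *)
Lemma simple_integralE (I : choiceType) (V : normedModType R)
    (r : R -> I) (F : I -> V) :
  finitely_valued r ->
  simple_integral D (F \o r) =
  \sum_(i \in range r) fine (mu (D `&` r @^-1` [set i])) *: F i.
Proof.
move=> fr; have [fFr _] := finitely_valued_comp F fr.
rewrite /simple_integral.
under eq_fsbigr => v _.
  rewrite -/(m _) m_preimage// fsbig_finite/=; last by case: fr.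
  rewrite scaler_suml -fsbig_finite/=; last by case: fr.
  over.
rewrite exchange_fsbig//=; last by case: fr.
apply: eq_fsbigr => i; rewrite inE => -[x _ rx].
rewrite (fsbigD1 (F i))//=; last by exists x => //=; rewrite rx.
rewrite eqxx fsbig1 ?addr0// => v [_ /= /eqP]; rewrite eq_sym => /negPf ->.
by rewrite scale0r.
Qed.

Lemma simple_integral_lin (V : normedModType R) (a : R) (s s' : R -> V) :
  simple_fun s -> simple_fun s' ->
  simple_integral D (fun x => a *: s x + s' x) =
  a *: simple_integral D s + simple_integral D s'.
Proof.
move=> /simple_funP fs /simple_funP fs'.
have fr := finitely_valued_pair fs fs'.
rewrite (simple_integralE (fun p => a *: p.1 + p.2) fr).
rewrite (simple_integralE fst fr) (simple_integralE snd fr).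
case: fr => fr _.
rewrite !fsbig_finite//= scaler_sumr -big_split/=.
by apply: eq_bigr => i _; rewrite scalerDr !scalerA mulrC.
Qed.

Lemma simple_integral_linear (V W : normedModType R) (L : {linear V -> W})
    (s : R -> V) :
  simple_fun s -> simple_integral D (L \o s) = L (simple_integral D s).
Proof.
move=> /simple_funP fs; rewrite simple_integralE// /simple_integral.
case: fs => fs _; rewrite !fsbig_finite//= linear_sum.
by apply: eq_bigr => i _; rewrite linearZ.
Qed.

Lemma ler_norm_simple_integral (V : normedModType R) (s : R -> V) :
  simple_fun s ->
  (`|simple_integral D s|%:E <= \int[mu]_(x in D) `|s x|%:E)%E.
Proof.
move=> /[dup] -[fs ms] /simple_funP fvs.
(* With the norm written as a finite sum of weighted indicators, the claim becomes the triangle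
   inequality for a finite sum. *)
rewrite [leRHS](_ : _ = (\int[mu]_(x in D)
    (\sum_(v \in range s) (`|v| * \1_(s @^-1` [set v]) x)%:E))%E); last first.
  apply: eq_integral => x _.
  rewrite (fsbigD1 (s x))//=; last by exists x.
  rewrite indicE mem_set// mulr1 fsbig1 ?adde0// => v [_ /= vs].
  by rewrite indicE memNset ?mulr0// => /= /esym.
rewrite ge0_integral_fsum//=; last first.
  by move=> v; apply/measurable_EFinP/measurable_funM => //; apply: measurable_indic; exact: ms.
have intE v : (\int[mu]_(x in D) (`|v| * \1_(s @^-1` [set v]) x)%:E)%E =
    (`|v| * fine (mu (D `&` s @^-1` [set v])))%:E.
  under eq_integral do rewrite EFinM.
  rewrite ge0_integralZl_EFin//; last first.
    by apply/measurable_EFinP; apply: measurable_indic; exact: ms.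
  rewrite integral_indic//; last exact: ms.
  by rewrite setIC EFinM fineK// mu_fin.
under eq_fsbigr do rewrite intE.
rewrite fsumEFin// lee_fin /simple_integral !fsbig_finite//=.
apply: le_trans (ler_norm_sum _ _ _) _; apply: ler_sum => v _.
by rewrite normrZ mulrC ger0_norm// fine_ge0.
Qed.

End integral.

End finitely_valued.

(** * Measurability and integrals of almost everywhere equal functions *)

Section nonmeasurable_integral.
Context d (T : measurableType d) (R : realType).
Variable (mu : {measure set T -> \bar R}).
Local Open Scope ereal_scope.
Import HBNNSimple.

(** No measurability is assumed, since the norm of a Bochner measurable function is only almost
    everywhere equal to a Borel function. The integral is a supremum over simple functions lying
    below; such a function for [f], set to zero on the exceptional null set, lies below [g] and
    keeps its integral. *)
Lemma ge0_ae_le_integral (D : set T) (f g : T -> \bar R) :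
  (forall x, D x -> 0 <= f x) -> (forall x, D x -> 0 <= g x) ->
  {ae mu, forall x, D x -> f x <= g x} ->
  \int[mu]_(x in D) f x <= \int[mu]_(x in D) g x.
Proof.
move=> f0 g0 [N [mN N0 subN]].
rewrite [leLHS]ge0_integralE// [leRHS]ge0_integralE//.
apply: ge_ereal_sup => _ [h /= hf <-].
pose k := proj_nnsfun h (measurableC mN).
have kE x : k x = (h x * \1_(~` N) x)%R by [].
rewrite [leLHS](_ : _ = sintegral mu k).
  apply: ereal_sup_ubound; exists k => // x; rewrite kE.
  have g0' : 0 <= (g \_ D) x by apply: erestrict_ge0.
  have [Nx|Nx] := pselect (N x).
    by rewrite indicE memNset ?mulr0//= => /(_ Nx).
  rewrite indicE mem_set// mulr1; apply: le_trans (hf x) _.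
  rewrite /patch; case: ifPn => // /set_mem Dx.
  by apply: contrapT => fg; apply: Nx; apply: subN => /= /(_ Dx).
have mN' : measurable (~` N) by exact: measurableC.
rewrite -!integralT_nnsfun.
rewrite (ge0_negligible_integral mN)//; last 2 first.
- by apply/measurable_EFinP.
- by move=> x _; rewrite lee_fin.
rewrite [RHS](ge0_negligible_integral mN)//; last 2 first.
- by apply/measurable_EFinP.
- by move=> x _; rewrite lee_fin.
apply: eq_integral => x; rewrite inE => -[_ Nx].
by rewrite kE indicE mem_set// mulr1.
Qed.

Lemma ge0_ae_eq_integral_nonmeasurable (D : set T) (f g : T -> \bar R) :
  (forall x, D x -> 0 <= f x) -> (forall x, D x -> 0 <= g x) ->
  {ae mu, forall x, D x -> f x = g x} ->
  \int[mu]_(x in D) f x = \int[mu]_(x in D) g x.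
Proof.
move=> f0 g0 fg; apply/eqP; rewrite eq_le.
apply/andP; split; apply: ge0_ae_le_integral => //.
- by apply: filterS fg => x + Dx => /(_ Dx) ->.
- by apply: filterS fg => x + Dx => /(_ Dx) ->.
Qed.

Lemma ge0_integral_subset (D E : set T) (f : T -> \bar R) :
  (forall x, E x -> 0 <= f x) -> D `<=` E ->
  \int[mu]_(x in D) f x <= \int[mu]_(x in E) f x.
Proof.
move=> f0 DE; rewrite [leLHS]integral_mkcond [leRHS]integral_mkcond.
have f0' x : D x -> 0 <= f x by move=> /DE /f0.
apply: ge0_ae_le_integral => //.
- by move=> x _; apply: erestrict_ge0.
- by move=> x _; apply: erestrict_ge0.
apply: nearW => x _; rewrite /patch; case: ifPn => [/set_mem/DE xE|_].
  by rewrite mem_set.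
by case: ifPn => // /set_mem/f0.
Qed.

End nonmeasurable_integral.

Section strongly_measurable.
Context {R : realType}.
Local Notation mu := (@lebesgue_measure R).

#[export] Instance lebesgue_ae_filter : Filter (nbhs (almost_everywhere mu)).
Proof. exact: ae_filter_ringOfSetsType. Qed.

(* Unlike [bochner_measurable], the approximation holds everywhere, so that
   [`|g|] is Borel measurable. *)
Definition strongly_measurable (V : normedModType R) (g : R -> V) : Prop :=
  exists2 s_ : nat -> R -> V, (forall n, simple_fun (s_ n)) &
    forall x, s_ n x @[n --> \oo] --> g x.

Lemma simple_strongly_measurable (V : normedModType R) (s : R -> V) :
  simple_fun s -> strongly_measurable s.
Proof. by move=> ss; exists (fun _ => s) => // x; exact: cvg_cst. Qed.

Lemma strongly_measurable_norm (V : normedModType R) (g : R -> V) (D : set R) :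
  strongly_measurable g -> measurable_fun D (fun x => `|g x|).
Proof.
move=> [s_ ss sg]; apply: (@measurable_funS _ _ _ _ setT) => //.
apply: (@measurable_fun_cvg _ _ _ _ (fun n x => `|s_ n x|)) => [n|x _].
  by apply: (@finitely_valued_measurable _ _ _ (@Num.norm _ _)); apply/simple_funP.
exact: cvg_norm.
Qed.

Lemma strongly_measurable_lin (V : normedModType R) (a : R) (f g : R -> V) :
  strongly_measurable f -> strongly_measurable g ->
  strongly_measurable (fun x => a *: f x + g x).
Proof.
move=> [s ss sf] [s' ss' sg]; exists (fun n x => a *: s n x + s' n x).
  by move=> n; exact: simple_fun_lin.
by move=> x; apply: cvgD => //; apply: cvgZr.
Qed.

(** The approximating sequence converges exactly where it is Cauchy, by completeness, and that set
    is measurable. Cutting the approximants to zero outside it makes them converge everywhere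
    without changing the limit almost everywhere on [D]. *)
Lemma bochner_measurable_rep (V : completeNormedModType R) (D : set R) (f : R -> V) :
  bochner_measurable D f ->
  exists2 g, strongly_measurable g & {ae mu, forall x, D x -> f x = g x}.
Proof.
move=> [s_ ss sf].
pose C := \bigcap_k \bigcup_N \bigcap_(n in [set n | (N <= n)%N])
  [set x | `|s_ n x - s_ N x| < k.+1%:R^-1].
have mC : measurable C.
  apply: bigcapT_measurable => k; apply: bigcupT_measurable => N.
  apply: bigcap_measurable => [|n _]; first by exists N => /=.
  have /simple_funP sn := ss n; have /simple_funP sN := ss N.
  have [_ mm] := finitely_valued_pair sn sN.
  exact: (mm [set p | `|p.1 - p.2| < k.+1%:R^-1]).
have CP x (l : V) : s_ n x @[n --> \oo] --> l -> C x.
  move=> /cvgn_normP sl k _.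
  have e0 : 0 < (k.+1%:R^-1 : R) / 2 by rewrite divr_gt0// invr_gt0 ltr0n.
  have [N hN] := sl _ e0.
  exists N => // n /= Nn; apply: le_lt_trans (ler_distD l _ _) _.
  rewrite (splitr k.+1%:R^-1); apply: ltrD; first exact: hN.
  by rewrite distrC; apply: hN.
have Ccvg x : C x -> cvg (s_ n x @[n --> \oo]).
  move=> Cx; apply/cvg_ex/cauchy_cvgn => e /invn_lt[k ke].
  have [N _ hN] := Cx k Logic.I; exists N => n Nn.
  by apply: lt_trans ke; exact: hN.
pose t n x := if x \in C then s_ n x else 0.
exists (fun x => lim (t n x @[n --> \oo])).
  exists t => [n|x].
    have /simple_funP sn := ss n.
    exact: (simple_fun_map (fun p : V * bool => if p.2 then p.1 else 0)
             (finitely_valued_pair sn (finitely_valued_indicator mC))).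
  have [Cx|Cx] := pselect (C x).
    rewrite (_ : t ^~ x = s_ ^~ x); first exact: Ccvg.
    by apply/funext => n; rewrite /t mem_set.
  rewrite (_ : t ^~ x = fun=> 0); first exact: is_cvg_cst.
  by apply/funext => n; rewrite /t memNset.
apply: filterS sf => x sf Dx; have sx := sf Dx.
have Cx : C x by apply: CP sx.
rewrite (_ : t ^~ x = s_ ^~ x); first by apply/esym/cvg_lim.
by apply/funext => n; rewrite /t mem_set.
Qed.

Lemma strongly_measurable_bochner (V : normedModType R) (D : set R) (f : R -> V) :
  strongly_measurable f -> bochner_measurable D f.
Proof. by move=> [s_ ss sf]; exists s_ => //; apply: nearW. Qed.

Lemma bochner_measurable_ae (V : normedModType R) (D : set R) (f g : R -> V) :
  {ae mu, forall x, D x -> f x = g x} ->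
  bochner_measurable D f -> bochner_measurable D g.
Proof.
move=> fg [s_ ss sf]; exists s_ => //.
by apply: filterS2 fg sf => x + + Dx => /(_ Dx) <- /(_ Dx).
Qed.

Lemma bochner_measurable_lin (V : normedModType R) (D : set R) (a : R) (f g : R -> V) :
  bochner_measurable D f -> bochner_measurable D g ->
  bochner_measurable D (fun x => a *: f x + g x).
Proof.
move=> [s ss sf] [s' ss' sg]; exists (fun n x => a *: s n x + s' n x).
  by move=> n; exact: simple_fun_lin.
apply: filterS2 sf sg => x + + Dx => /(_ Dx) fx /(_ Dx) gx.
by apply: cvgD => //; apply: cvgZr.
Qed.

Lemma bochner_measurableB (V : normedModType R) (D : set R) (f g : R -> V) :
  bochner_measurable D f -> bochner_measurable D g ->
  bochner_measurable D (fun x => f x - g x).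
Proof.
move=> bf bg; have := bochner_measurable_lin (-1) bg bf.
by congr bochner_measurable; apply/funext => x; rewrite scaleN1r addrC.
Qed.

Lemma bochner_measurable_cst (V : normedModType R) (D : set R) (v : V) :
  bochner_measurable D (fun _ => v).
Proof.
apply/strongly_measurable_bochner/simple_strongly_measurable.
exact: simple_fun_cst.
Qed.

Lemma bochner_measurableZ (V : normedModType R) (D : set R) (a : R) (f : R -> V) :
  bochner_measurable D f -> bochner_measurable D (fun x => a *: f x).
Proof.
move=> bf; have := bochner_measurable_lin a bf (bochner_measurable_cst D 0).
by congr bochner_measurable; apply/funext => x; rewrite addr0.
Qed.

Lemma bochner_measurable_subset (V : normedModType R) (D E : set R) (f : R -> V) :
  D `<=` E -> bochner_measurable E f -> bochner_measurable D f.
Proof.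
by move=> DE [s ss sf]; exists s => //; apply: filterS sf => x + /DE.
Qed.

End strongly_measurable.

Section L1_seminorm.
Context {R : realType}.
Local Notation mu := (@lebesgue_measure R).
Implicit Type D : set R.

Definition eL1_norm (V : normedModType R) D (f : R -> V) : \bar R :=
  (\int[mu]_(x in D) `|f x|%:E)%E.

Lemma eL1_norm_ge0 (V : normedModType R) D (f : R -> V) : (0 <= eL1_norm D f)%E.
Proof. by apply: integral_ge0 => x _; rewrite lee_fin. Qed.

Lemma eL1_normE (V : normedModType R) D (f : R -> V) :
  L1_mem D f -> eL1_norm D f = (L1_norm D f)%:E.
Proof.
by move=> [_ ?]; rewrite /L1_norm fineK// ge0_fin_numE//; exact: eL1_norm_ge0.
Qed.

Lemma eL1_norm_eq (V : normedModType R) D (f g : R -> V) :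
  (forall x, D x -> f x = g x) -> eL1_norm D f = eL1_norm D g.
Proof. by move=> fg; apply: eq_integral => x /set_mem /fg ->. Qed.

Lemma eL1_norm_ae (V : normedModType R) D (f g : R -> V) :
  {ae mu, forall x, D x -> f x = g x} -> eL1_norm D f = eL1_norm D g.
Proof.
move=> fg; apply: ge0_ae_eq_integral_nonmeasurable => //.
by apply: filterS fg => x + Dx => /(_ Dx) ->.
Qed.

Lemma eL1_norm_subset (V : normedModType R) D (E : set R) (f : R -> V) :
  D `<=` E -> (eL1_norm D f <= eL1_norm E f)%E.
Proof. by move=> DE; apply: ge0_integral_subset => // x _; rewrite lee_fin. Qed.

Lemma eL1_norm_le_scale (V : normedModType R) (W : completeNormedModType R) D
    (M : R) (f : R -> V) (g : R -> W) :
  measurable D -> 0 <= M -> bochner_measurable D g ->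
  {ae mu, forall x, D x -> `|f x| <= M * `|g x|} ->
  (eL1_norm D f <= M%:E * eL1_norm D g)%E.
Proof.
move=> mD M0 /bochner_measurable_rep[g' sg gg'] fg; rewrite (eL1_norm_ae gg') /eL1_norm.
rewrite -ge0_integralZl_EFin//; last first.
  by apply/measurable_EFinP; exact: strongly_measurable_norm.
apply: ge0_ae_le_integral => //.
- by move=> x _; rewrite mule_ge0.
- apply: filterS2 gg' fg => x + + Dx => /(_ Dx) <- /(_ Dx).
  by rewrite -EFinM lee_fin.
Qed.

Lemma eL1_norm_le_const (V : normedModType R) D (M : R) (f : R -> V) :
  measurable D -> 0 <= M -> {ae mu, forall x, D x -> `|f x| <= M} ->
  (eL1_norm D f <= M%:E * mu D)%E.
Proof.
move=> mD M0 fM; rewrite -integral_cst//.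
exact: ge0_ae_le_integral.
Qed.

Lemma eL1_normD (V : completeNormedModType R) D (f g : R -> V) :
  measurable D -> bochner_measurable D f -> bochner_measurable D g ->
  (eL1_norm D (fun x => f x + g x)%R <= eL1_norm D f + eL1_norm D g)%E.
Proof.
move=> mD /bochner_measurable_rep[f' sf ff'] /bochner_measurable_rep[g' sg gg'].
rewrite (eL1_norm_ae ff') (eL1_norm_ae gg') /eL1_norm -ge0_integralD//; last 2 first.
- by apply/measurable_EFinP; exact: strongly_measurable_norm.
- by apply/measurable_EFinP; exact: strongly_measurable_norm.
apply: ge0_ae_le_integral => //.
- by move=> x _; rewrite adde_ge0.
- apply: filterS2 ff' gg' => x + + Dx => /(_ Dx) -> /(_ Dx) ->.
  by rewrite -EFinD lee_fin ler_normD.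
Qed.

Lemma eL1_normZ (V : completeNormedModType R) D (a : R) (f : R -> V) :
  measurable D -> bochner_measurable D f ->
  eL1_norm D (fun x => a *: f x) = (`|a|%:E * eL1_norm D f)%E.
Proof.
move=> mD /bochner_measurable_rep[f' sf ff'].
rewrite (eL1_norm_ae ff') /eL1_norm -ge0_integralZl_EFin//; last first.
  by apply/measurable_EFinP; exact: strongly_measurable_norm.
apply: ge0_ae_eq_integral_nonmeasurable => //.
apply: filterS ff' => x + Dx => /(_ Dx) ->.
by rewrite normrZ EFinM.
Qed.

Lemma eL1_normB (V : completeNormedModType R) D (f g h : R -> V) :
  measurable D -> bochner_measurable D f -> bochner_measurable D g ->
  bochner_measurable D h ->
  (eL1_norm D (fun x => f x - g x)%R <=
   eL1_norm D (fun x => h x - f x)%R + eL1_norm D (fun x => h x - g x)%R)%E.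
Proof.
move=> mD bf bg bh.
rewrite (_ : eL1_norm D (fun x => h x - f x) = eL1_norm D (fun x => f x - h x)).
  apply: le_trans (eL1_normD mD (bochner_measurableB bf bh) (bochner_measurableB bh bg)).
  by rewrite le_eqVlt (@eL1_norm_eq _ _ _ (fun x => (f x - h x) + (h x - g x)))
    ?eqxx// => x _; rewrite subrKA.
by apply: eq_integral => x _; rewrite distrC.
Qed.

Lemma L1_mem_lin (V : completeNormedModType R) D (a : R) (f g : R -> V) :
  measurable D -> L1_mem D f -> L1_mem D g -> L1_mem D (fun x => a *: f x + g x).
Proof.
move=> mD [bf fi] [bg gi]; split; first exact: bochner_measurable_lin.
have baf := bochner_measurableZ a bf.
apply: le_lt_trans (eL1_normD mD baf bg) _.
by rewrite eL1_normZ// lte_add_pinfty// lte_mul_pinfty// lee_fin.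
Qed.

Lemma L1_mem_subset (V : normedModType R) D (E : set R) (f : R -> V) :
  D `<=` E -> L1_mem E f -> L1_mem D f.
Proof.
move=> DE [bf fi]; split; first exact: bochner_measurable_subset bf.
exact: le_lt_trans (eL1_norm_subset f DE) fi.
Qed.

Lemma simple_fun_bounded (V : normedModType R) (s : R -> V) : simple_fun s ->
  exists2 M, 0 <= M & forall x, `|s x| <= M.
Proof.
move=> [fs _]; exists (\sum_(v \in range s) `|v|) => [|x]; first exact: fsumr_ge0.
by rewrite (fsbigD1 (s x))//=; [rewrite lerDl fsumr_ge0|exists x].
Qed.

Lemma L1_mem_simple (V : normedModType R) D (s : R -> V) :
  measurable D -> (mu D < +oo)%E -> simple_fun s -> L1_mem D s.
Proof.
move=> mD fD ss; split.
  exact/strongly_measurable_bochner/simple_strongly_measurable.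
have [M M0 hM] := simple_fun_bounded ss.
apply: le_lt_trans (@eL1_norm_le_const V D M s mD M0 _) _; first exact: nearW.
by rewrite lte_mul_pinfty.
Qed.

(* Truncating the approximation [s_] where it exceeds [2 |g|] makes dominated
   convergence applicable and keeps simple functions simple. *)
Lemma L1_simple_approx (V : completeNormedModType R) D (f : R -> V) :
  measurable D -> L1_mem D f ->
  exists2 s_ : nat -> R -> V, (forall n, simple_fun (s_ n)) &
    eL1_norm D (fun x => f x - s_ n x) @[n --> \oo] --> 0%E.
Proof.
move=> mD [/bochner_measurable_rep[g [t st tg] fg] fi].
have sg : strongly_measurable g by exists t.
pose E n := [set x | `|t n x| <= 2 * `|g x|].
have mE n : measurable (E n).
  rewrite (_ : E n = (fun x => 2 * `|g x| - `|t n x|) @^-1` `[0, +oo[).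
    rewrite -[X in measurable X]setTI.
    have mm : measurable_fun setT (fun x => 2 * `|g x| - `|t n x|).
      apply: measurable_funB.
        by apply: measurable_funM => //; exact: strongly_measurable_norm.
      by apply: strongly_measurable_norm; exact: simple_strongly_measurable.
    exact: (mm measurableT _ (measurable_itv _)).
  by apply/seteqP; split=> x; rewrite /E /= in_itv/= andbT subr_ge0.
pose s n x := if x \in E n then t n x else 0.
have ss n : simple_fun (s n).
  have /simple_funP sn := st n.
  exact: (simple_fun_map (fun p : V * bool => if p.2 then p.1 else 0)
             (finitely_valued_pair sn (finitely_valued_indicator (mE n)))).
have s2 n x : `|s n x| <= 2 * `|g x|.
  by rewrite /s; case: ifPn => [/set_mem//|_]; rewrite normr0 mulr_ge0.
(* Where [g] vanishes the truncation forces [s n x = 0]. Elsewhere [t n x] is eventually within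
   [|g x|] of [g x], so its norm is at most [2 * |g x|] and the truncation no longer acts. *)
have sg0 x : `|g x - s n x| @[n --> \oo] --> 0.
  have [gx0|gx0] := eqVneq (g x) 0.
    rewrite (_ : (fun n => _) = fun _ => 0); first exact: cvg_cst.
    apply/funext => n; have := s2 n x; rewrite gx0 normr0 mulr0 normr_le0 => /eqP ->.
    by rewrite subr0 normr0.
  rewrite -(normr0 V); apply: cvg_norm; rewrite -(subrr (g x)).
  apply: cvgB; first exact: cvg_cst.
  apply/cvgn_normP => e e0.
  have g0 : 0 < `|g x| by rewrite normr_gt0.
  have [N1 h1] := (cvgn_normP _ _).1 (tg x) e e0.
  have [N2 h2] := (cvgn_normP _ _).1 (tg x) _ g0.
  exists (maxn N1 N2) => n; rewrite geq_max => /andP[n1 n2].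
  rewrite /s mem_set; first exact: h1.
  rewrite /E /= -[t n x](subrK (g x)); apply: le_trans (ler_normD _ _) _.
  by have := h2 _ n2; lra.
exists s => //.
rewrite (_ : (fun n => _) = fun n => \int[mu]_(x in D) `| `|g x - s n x|%:E - 0|)%E; last first.
  apply/funext => n; transitivity (eL1_norm D (fun x => g x - s n x)).
    by apply: eL1_norm_ae; apply: filterS fg => x + Dx => /(_ Dx) ->.
  by apply: eq_integral => x _; rewrite sube0 abse_EFin normr_id.
have mgs n : measurable_fun D (fun x => `|g x - s n x|).
  rewrite (_ : (fun x => _) = (fun x => `|(-1) *: s n x + g x|)).
    apply: strongly_measurable_norm; apply: strongly_measurable_lin => //.
    exact: simple_strongly_measurable.
  by apply/funext => x; rewrite scaleN1r addrC.
(* The dominating function is [|g| + 2 |g|], one summand for [g] and one for the truncated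
   approximant. *)
have [] := @dominated_convergence _ _ _ mu D mD
  (fun n x => `|g x - s n x|%:E) (fun=> 0%E) (fun x => (3 * `|g x|)%:E).
- by move=> n; apply/measurable_EFinP; exact: mgs.
- exact: measurable_cst.
- by apply: nearW => x _; apply: cvg_EFin => //; [exact: nearW|exact: sg0].
- apply/integrableP; split.
    apply/measurable_EFinP/measurable_funM => //.
    exact: strongly_measurable_norm.
  rewrite (_ : (\int[_]_(_ in _) _)%E = (3%:E * eL1_norm D g)%E).
    rewrite -(eL1_norm_ae fg) lte_mul_pinfty//.
  rewrite -ge0_integralZl_EFin//; last first.
    by apply/measurable_EFinP; exact: strongly_measurable_norm.
  by apply: eq_integral => x _; rewrite abse_EFin ger0_norm ?mulr_ge0.
- apply: nearW => x n _; rewrite abse_EFin normr_id lee_fin.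
  by have := ler_normB (g x) (s n x); have := s2 n x; lra.
by [].
Qed.

End L1_seminorm.

(** * The Bochner integral *)

Section bochner_integral_theory.
Context {R : realType}.
Local Notation mu := (@lebesgue_measure R).

Lemma cvge0_lt (u : nat -> \bar R) (e : R) :
  u n @[n --> \oo] --> 0%E -> 0 < e -> exists N, forall n, (N <= n)%N -> (u n < e%:E)%E.
Proof.
move=> u0 e0.
have : nbhs (0%E : \bar R) [set x | (x < e%:E)%E].
  by apply: open_nbhs_nbhs; split; [exact: open_ereal_lt_ereal|rewrite /= lte_fin].
by move=> /u0[N _ hN]; exists N => n Nn; exact: hN.
Qed.

Lemma le_cvge0 (u v : nat -> \bar R) :
  (forall n, 0 <= u n)%E -> (forall n, u n <= v n)%E ->
  v n @[n --> \oo] --> 0%E -> u n @[n --> \oo] --> 0%E.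
Proof.
move=> u0 uv v0; apply: (@squeeze_cvge _ _ _ _ (fun=> 0%E) _ v) => //.
- by apply: nearW => n; rewrite u0 uv.
- exact: cvg_cst.
Qed.

Lemma limn_unique (V : normedModType R) (u : nat -> V) (l l' : V) :
  u n @[n --> \oo] --> l -> u n @[n --> \oo] --> l' -> l = l'.
Proof. by apply: cvg_unique; exact: norm_hausdorff. Qed.

Section finite_measure.
Variables (D : set R) (mD : measurable D) (finD : (mu D < +oo)%E).

Section complete.
Variable V : completeNormedModType R.
Implicit Types (f g s : R -> V).

Lemma simple_bochner_measurable s : simple_fun s -> bochner_measurable D s.
Proof. by move=> ?; apply/strongly_measurable_bochner/simple_strongly_measurable. Qed.

Lemma simple_integral_dist f s s' : bochner_measurable D f ->
  simple_fun s -> simple_fun s' ->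
  (`|simple_integral D s - simple_integral D s'|%:E <=
   eL1_norm D (fun x => f x - s x)%R + eL1_norm D (fun x => f x - s' x)%R)%E.
Proof.
move=> bf ss ss'.
apply: le_trans (eL1_normB mD (simple_bochner_measurable ss)
  (simple_bochner_measurable ss') bf).
have := ler_norm_simple_integral mD finD (simple_fun_lin (-1) ss' ss).
rewrite simple_integral_lin// scaleN1r addrC => /le_trans; apply.
rewrite le_eqVlt; apply/orP; left; apply/eqP/eq_integral => x _.
by rewrite scaleN1r addrC.
Qed.

(** The integral is defined by choice, so a limit must exist and must not depend on the
    approximating sequence. Both follow from [simple_integral_dist]: comparing [s_] with itself
    gives a Cauchy sequence, comparing it with a rival sequence gives uniqueness. *)
Lemma bochner_integralP f (s_ : nat -> R -> V) :
  bochner_measurable D f -> (forall n, simple_fun (s_ n)) ->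
  eL1_norm D (fun x => f x - s_ n x) @[n --> \oo] --> 0%E ->
  simple_integral D (s_ n) @[n --> \oo] --> bochner_integral D f.
Proof.
move=> bf ss s0.
have close (s' : nat -> R -> V) e : (forall n, simple_fun (s' n)) ->
    eL1_norm D (fun x => f x - s' n x) @[n --> \oo] --> 0%E -> 0 < e ->
    exists N, forall n m, (N <= n)%N -> (N <= m)%N ->
      `|simple_integral D (s_ n) - simple_integral D (s' m)| < e.
  move=> ss' s'0 e0; have e20 : 0 < e / 2 by rewrite divr_gt0.
  have [N1 h1] := cvge0_lt s0 e20; have [N2 h2] := cvge0_lt s'0 e20.
  exists (maxn N1 N2) => n m; rewrite !geq_max => /andP[n1 _] /andP[_ m2].
  rewrite -lte_fin (splitr e) EFinD.
  apply: le_lt_trans (simple_integral_dist bf (ss n) (ss' m)) _.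
  by apply: lteD; [exact: h1|exact: h2].
have [v sv] : exists v : V, simple_integral D (s_ n) @[n --> \oo] --> v.
  apply: cauchy_cvgn => e e0; have [N hN] := close _ _ ss s0 e0.
  by exists N => n Nn; exact: hN.
suff -> : bochner_integral D f = v by [].
apply: xget_unique; first by split => //; exists s_.
move=> w [_ [s' [ss' s'0 s'w]]].
apply/eqP; rewrite -subr_eq0 -normr_le0; apply/ler_addgt0Pl => e e0.
have e3 : 0 < e / 3 by rewrite divr_gt0.
have [N1 h1] := (cvgn_normP _ _).1 sv _ e3.
have [N2 h2] := (cvgn_normP _ _).1 s'w _ e3.
have [N3 h3] := close _ _ ss' s'0 e3.
pose n := maxn N1 (maxn N2 N3).
have := h1 n (leq_maxl _ _).
have := h2 n (leq_trans (leq_maxl _ _) (leq_maxr _ _)).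
have n3 := leq_trans (leq_maxr N2 N3) (leq_maxr N1 _).
have := h3 n n n3 n3.
set a := simple_integral _ _; set b := simple_integral _ _ => h ? ?.
have := ler_distD b w v; have := ler_distD a b v.
by rewrite addr0 (distrC w b) (distrC b a); lra.
Qed.

Lemma bochner_integral_lin (a : R) f g : L1_mem D f -> L1_mem D g ->
  bochner_integral D (fun x => a *: f x + g x) =
  a *: bochner_integral D f + bochner_integral D g.
Proof.
move=> L1f L1g; have [bf _] := L1f; have [bg _] := L1g.
have [s ss s0] := L1_simple_approx mD L1f.
have [t st t0] := L1_simple_approx mD L1g.
have cl : simple_integral D (fun x => a *: s n x + t n x) @[n --> \oo] -->
    a *: bochner_integral D f + bochner_integral D g.
  under eq_cvg do rewrite simple_integral_lin//.
  by apply: cvgD; [apply: cvgZr|]; exact: bochner_integralP.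
apply: limn_unique cl.
apply: bochner_integralP => [|n|]; first exact: bochner_measurable_lin.
  exact: simple_fun_lin.
have bfs n := bochner_measurableB bf (simple_bochner_measurable (ss n)).
have bgt n := bochner_measurableB bg (simple_bochner_measurable (st n)).
apply: (@le_cvge0 _ (fun n => `|a|%:E * eL1_norm D (fun x => f x - s n x)%R +
                           eL1_norm D (fun x => g x - t n x)%R)%E).
- by move=> n; exact: eL1_norm_ge0.
- move=> n; rewrite -eL1_normZ//.
  apply: le_trans (eL1_normD mD (bochner_measurableZ a (bfs n)) (bgt n)).
  rewrite le_eqVlt; apply/orP; left; apply/eqP/eL1_norm_eq => x _.
  by rewrite scalerBr opprD addrACA.
- rewrite [X in _ --> X](_ : _ = `|a|%:E * 0 + 0)%E; last by rewrite mule0 adde0.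
  by apply: cvgeD => //; exact: cvgeZl.
Qed.

Lemma ler_norm_bochner_integral f : L1_mem D f ->
  (`|bochner_integral D f|%:E <= eL1_norm D f)%E.
Proof.
move=> L1f; have [bf _] := L1f.
have [s ss s0] := L1_simple_approx mD L1f.
have sv := bochner_integralP bf ss s0.
apply/lee_addgt0Pr => e e0; have e20 : 0 < e / 2 by rewrite divr_gt0.
have [N1 h1] := (cvgn_normP _ _).1 sv _ e20.
have [N2 h2] := cvge0_lt s0 e20.
pose n := maxn N1 N2.
have {}h1 := h1 n (leq_maxl _ _); have {}h2 := h2 n (leq_maxr _ _).
have h3 := ler_norm_simple_integral mD finD (ss n).
have h4 : (eL1_norm D (s n) <= eL1_norm D f + (e / 2)%:E)%E.
  have bz := bochner_measurable_cst D (0 : V).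
  have := eL1_normB mD (simple_bochner_measurable (ss n)) bz bf.
  rewrite (@eL1_norm_eq _ _ _ _ (s n)); last by move=> x _; rewrite subr0.
  rewrite [X in (_ + X)%E](@eL1_norm_eq _ _ _ _ f); last by move=> x _; rewrite subr0.
  by move=> /le_trans; apply; rewrite addeC leeD2l// ltW.
rewrite (splitr e) EFinD addeA.
apply: le_trans (leeD2r _ (le_trans h3 h4)).
rewrite -EFinD lee_fin.
rewrite -[bochner_integral D f](subKr (simple_integral D (s n))).
by apply: le_trans (ler_normB _ _) _; rewrite lerD2l ltW.
Qed.

End complete.

Lemma bochner_integral_linear (V W : completeNormedModType R) (L : {linear V -> W})
    (M : R) (f : R -> V) :
  0 <= M -> (forall v, `|L v| <= M * `|v|) -> L1_mem D f ->
  L1_mem D (L \o f) /\ bochner_integral D (L \o f) = L (bochner_integral D f).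
Proof.
move=> M0 LM L1f; have [bf fi] := L1f.
have cL (u : nat -> V) l : u n @[n --> \oo] --> l -> L (u n) @[n --> \oo] --> L l.
  move=> /cvgn_normP ul; apply/cvgn_normP => e e0.
  have M1 : 0 < M + 1 by rewrite ltr_wpDl.
  have [N hN] := ul (e / (M + 1)) (divr_gt0 e0 M1); exists N => n /hN un.
  rewrite -linearB; apply: le_lt_trans (LM _) _.
  have : `|u n - l| * (M + 1) < e by rewrite -ltr_pdivlMr.
  by have := normr_ge0 (u n - l); lra.
have bLf : bochner_measurable D (L \o f).
  have [s ss sf] := bf; exists (fun n => L \o s n) => [n|].
    by apply: simple_fun_map; apply/simple_funP.
  by apply: filterS sf => x + Dx => /(_ Dx) /cL.
have L1Lf : L1_mem D (L \o f).
  split => //; have := @eL1_norm_le_scale _ _ _ D M (L \o f) f mD M0 bf.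
  move=> /(_ (nearW _ _)) h; apply: le_lt_trans (h _) _; first by move=> x _; exact: LM.
  by rewrite lte_mul_pinfty.
split => //.
have [s ss s0] := L1_simple_approx mD L1f.
have sv := cL _ _ (bochner_integralP bf ss s0).
apply: limn_unique sv.
under eq_cvg do rewrite -simple_integral_linear//.
apply: bochner_integralP => // [n|].
  by apply: simple_fun_map; apply/simple_funP.
apply: (@le_cvge0 _ (fun n => M%:E * eL1_norm D (fun x => f x - s n x)%R)%E).
- by move=> n; exact: eL1_norm_ge0.
- move=> n; apply: eL1_norm_le_scale => //; last first.
    by apply: nearW => x _; rewrite /= -linearB.
  exact/bochner_measurableB/simple_bochner_measurable.
- rewrite [X in _ --> X](_ : _ = M%:E * 0)%E; last by rewrite mule0.
  by apply: cvgeZl.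
Qed.

(** Integrability is not assumed: both functions have the same set of candidate integrals, so [xget]
    returns the same value, even when it is the default 0. *)
Lemma bochner_integral_eq (V : normedModType R) (f g : R -> V) :
  (forall x, D x -> f x = g x) -> bochner_integral D f = bochner_integral D g.
Proof.
have sub (f' g' : R -> V) : (forall x, D x -> f' x = g' x) ->
    is_bochner_integral D f' `<=` is_bochner_integral D g'.
  move=> fg v [bf [s [ss s0 sv]]]; split.
    by apply: bochner_measurable_ae bf; apply: nearW.
  exists s; split => //.
  rewrite (_ : (fun n => _) = (fun n => eL1_norm D (fun x => f' x - s n x)))//.
  by apply/funext => n; apply: eL1_norm_eq => x /fg ->.
move=> fg; rewrite /bochner_integral; congr (xget _ _).
by apply/seteqP; split; apply: sub => // x /fg.
Qed.

End finite_measure.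

(** Additivity is asked of the measure rather than of the sets, because an open interval cut at a
    point is not the union of the two open pieces. *)
Lemma bochner_integral_additive (V : completeNormedModType R) (D D1 D2 : set R)
    (f : R -> V) :
  measurable D -> measurable D1 -> measurable D2 -> (mu D < +oo)%E ->
  D1 `<=` D -> D2 `<=` D ->
  (forall A, measurable A -> mu (D `&` A) = (mu (D1 `&` A) + mu (D2 `&` A))%E) ->
  L1_mem D f ->
  bochner_integral D f = bochner_integral D1 f + bochner_integral D2 f.
Proof.
move=> mD mD1 mD2 finD D1D D2D muD L1f.
have [s ss s0] := L1_simple_approx mD L1f; have [bf _] := L1f.
have finS (E : set R) : measurable E -> E `<=` D -> (mu E < +oo)%E.
  by move=> mE ED; apply: le_lt_trans finD; apply: le_measure; rewrite ?inE.
have sub (E : set R) : measurable E -> E `<=` D ->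
    simple_integral E (s n) @[n --> \oo] --> bochner_integral E f.
  move=> mE ED; apply: bochner_integralP => //; first exact: finS.
    exact: bochner_measurable_subset bf.
  apply: le_cvge0 s0 => n; first exact: eL1_norm_ge0.
  exact: eL1_norm_subset.
apply: limn_unique (sub D mD (@subset_refl _ _)) _.
have E n : simple_integral D (s n) =
    simple_integral D1 (s n) + simple_integral D2 (s n).
  rewrite /simple_integral.
  have [fs ms] := ss n; rewrite !fsbig_finite//= -big_split/=.
  apply: eq_bigr => v _; rewrite -scalerDl muD; last exact: ms.
  rewrite fineD// ge0_fin_numE//; apply: finS.
  - by apply: measurableI => //; exact: ms.
  - exact: subset_trans (@subIsetl _ _ _) D1D.
  - by apply: measurableI => //; exact: ms.
  - exact: subset_trans (@subIsetl _ _ _) D2D.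
by under eq_cvg do rewrite E; apply: cvgD; exact: sub.
Qed.

End bochner_integral_theory.

(** * Translation invariance of Lebesgue measure and of Bochner integrals *)

Section translation.
Context {R : realType}.
Local Notation mu := (@lebesgue_measure R).
Implicit Type D : set R.
Variable a : R.
Local Notation tau := (fun x : R => x + a).

Let measurable_tau : measurable_fun setT (tau : measurableTypeR R -> measurableTypeR R).
Proof. exact: measurable_funD. Qed.

Lemma measurable_translation D : measurable D -> measurable (tau @^-1` D).
Proof.
by move=> mD; rewrite -[X in measurable X]setTI; exact: measurable_tau.
Qed.

Lemma itv_translation (c d : R) : tau @^-1` `]c, d[ = `](c - a), (d - a)[%classic.
Proof. by apply/seteqP; split=> x /=; rewrite !in_itv/= ltrBlDr ltrBrDr. Qed.

(** The image measure under the translation agrees with Lebesgue measure on half-open intervals, and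
    this determines Lebesgue measure. *)
Lemma lebesgue_measure_translation D : measurable D -> mu (tau @^-1` D) = mu D.
Proof.
move=> mD.
apply/esym/(@lebesgue_measure_unique _ (pushforward mu (tau : _ -> measurableTypeR R))) => //.
move=> _ [[c d] _ <-] /=.
transitivity (mu `](c - a), (d - a)]); last first.
  congr (mu _); apply/seteqP; split=> x /=; rewrite !in_itv/= ltrBlDr lerBrDr//.
rewrite !lebesgue_measure_itv/= !lte_fin ltrBlDr subrK; case: ifP => // _.
by rewrite -!EFinD; congr EFin; rewrite opprB addrA subrK.
Qed.

Lemma ae_translation (P : set R) : {ae mu, forall x, P x} -> {ae mu, forall x, P (tau x)}.
Proof.
move=> [N [mN N0 subN]]; exists (tau @^-1` N); split.
- exact: measurable_translation.
- by rewrite lebesgue_measure_translation.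
- by move=> x; exact: (subN (tau x)).
Qed.

Lemma finitely_valued_translation (I : Type) (r : R -> I) :
  finitely_valued r -> finitely_valued (r \o tau).
Proof.
move=> [fr mr]; split=> [|Y].
  by apply: sub_finite_set fr => _ [x _ <-]; exists (tau x).
exact: (measurable_translation (mr Y)).
Qed.

Section functions.
Variable V : completeNormedModType R.
Implicit Types f s : R -> V.

Lemma simple_fun_translation s : simple_fun s -> simple_fun (s \o tau).
Proof. by move=> /simple_funP ?; apply/simple_funP/finitely_valued_translation. Qed.

Lemma bochner_measurable_translation D f :
  bochner_measurable D f -> bochner_measurable (tau @^-1` D) (f \o tau).
Proof.
move=> [s ss sf]; exists (fun n => s n \o tau) => [n|].
  exact: simple_fun_translation.
exact: (ae_translation sf).
Qed.

Lemma eL1_norm_translation D f : measurable D -> bochner_measurable D f ->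
  eL1_norm (tau @^-1` D) (f \o tau) = eL1_norm D f.
Proof.
move=> mD /bochner_measurable_rep[g sg fg].
rewrite (eL1_norm_ae fg) (eL1_norm_ae (ae_translation fg)) /eL1_norm.
rewrite -[LHS](@ge0_integral_pushforward _ _ _ _ _ (tau : measurableTypeR R -> measurableTypeR R)
  measurable_tau mu D (fun x => `|g x|%:E))//.
- by apply: eq_measure_integral => A mA _; exact: lebesgue_measure_translation.
- by apply/measurable_EFinP; exact: strongly_measurable_norm.
Qed.

Lemma L1_mem_translation D f : measurable D -> L1_mem D f ->
  L1_mem (tau @^-1` D) (f \o tau).
Proof.
move=> mD [bf fi]; split; first exact: bochner_measurable_translation.
by rewrite -/(eL1_norm _ _) eL1_norm_translation.
Qed.

Lemma simple_integral_translation D s : measurable D -> simple_fun s ->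
  simple_integral (tau @^-1` D) (s \o tau) = simple_integral D s.
Proof.
move=> mD [fs ms]; rewrite /simple_integral.
have -> : range (s \o tau) = range s.
  apply/seteqP; split=> _ [x _ <-]; first by exists (tau x).
  by exists (x - a) => //=; rewrite subrK.
apply: eq_fsbigr => v _; congr (fine _ *: _).
rewrite -[RHS]lebesgue_measure_translation//.
by apply: measurableI => //; exact: ms.
Qed.

Lemma bochner_integral_translation D f : measurable D -> (mu D < +oo)%E ->
  L1_mem D f ->
  bochner_integral (tau @^-1` D) (f \o tau) = bochner_integral D f.
Proof.
move=> mD finD L1f; have [bf _] := L1f.
have [s ss s0] := L1_simple_approx mD L1f.
apply: limn_unique (bochner_integralP mD finD bf ss s0).
under eq_cvg => n do rewrite -(simple_integral_translation mD (ss n)).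
apply: bochner_integralP.
- exact: measurable_translation.
- by rewrite lebesgue_measure_translation.
- exact: bochner_measurable_translation.
- by move=> n; exact: simple_fun_translation.
rewrite (_ : (fun n => _) = (fun n => eL1_norm D (fun x => f x - s n x)%R))//.
apply/funext => n.
rewrite -[RHS]eL1_norm_translation//.
exact/bochner_measurableB/simple_bochner_measurable.
Qed.

End functions.

End translation.

(** * The semigroup on the extrapolation space *)

Lemma continuous_linear_bound (R : realType) (V W : normedModType R) (L : {linear V -> W}) :
  continuous L -> exists2 M, 0 <= M & forall x, `|L x| <= M * `|x|.
Proof.
move=> cL; have : \forall x \near (0 : V), `|L 0 - L x| < 1.
  by have /cvgrPdist_lt := cL 0; apply.
rewrite -nbhs_nearE -nbhs_ballE => -[d /= d0 hd].
exists (2 / d) => [|x]; first by rewrite divr_ge0// ltW.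
have [->|x0] := eqVneq x 0; first by rewrite linear0 !normr0 mulr0.
have nx : 0 < `|x| by rewrite normr_gt0.
have c0 : 0 < d / 2 / `|x| by rewrite !divr_gt0.
have : `|L (d / 2 / `|x| *: x)| < 1.
  rewrite -normrN -sub0r -(linear0 L); apply: hd; rewrite -ball_normE /= sub0r normrN.
  by rewrite normrZ gtr0_norm// divfK ?gt_eqF// ltr_pdivrMr// ltr_pMr// ltr1n.
rewrite linearZ/= normrZ gtr0_norm// => h; apply: ltW.
rewrite -(ltr_pM2l c0); apply: lt_le_trans h _.
rewrite (_ : _ * _ = 1)//; field.
by rewrite !gt_eqF.
Qed.

Lemma cvg_at_right0P (R : realType) (V : normedModType R) (f : R -> V) (l : V) :
  f h @[h --> 0^'+] --> l <->
  forall e, 0 < e -> exists2 d, 0 < d & forall h, 0 < h -> h < d -> `|f h - l| < e.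
Proof.
split=> [/cvgrPdist_lt fl e e0|fl].
  have := fl e e0; rewrite near_withinE -nbhs_nearE -nbhs_ballE => -[d /= d0 hd].
  exists d => // h h0 hd'; rewrite distrC; apply: hd => //.
  by rewrite -ball_normE /= sub0r normrN gtr0_norm.
apply/cvgrPdist_lt => e e0; have [d d0 hd] := fl e e0.
rewrite near_withinE -nbhs_nearE -nbhs_ballE; exists d => //= h.
rewrite -ball_normE /= sub0r normrN => hd' h0; rewrite distrC; apply: hd => //.
exact: le_lt_trans (ler_norm _) hd'.
Qed.

Section semigroup.
Context {R : realType} {X Y : completeNormedModType R}.
Variables (A : operator X) (T : R -> {linear X -> X}).
Hypotheses (hT : C0_semigroup T) (hA : generates A T).

Lemma generator_semigroup (x : X) (t : R) : 0 <= t -> dom A x ->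
  dom A (T t x) /\ A (T t x) = T t (A x).
Proof.
move=> t0 Ax; have [cT T0 TD _] := hT; have [domA valA] := hA.
have [M M0 hM] := continuous_linear_bound (cT t t0).
have lim : h^-1 *: (T h (T t x) - T t x) @[h --> 0^'+] --> T t (A x).
  apply/cvg_at_right0P => e e0.
  have M1 : 0 < M + 1 by rewrite ltr_wpDl.
  have [d d0 hd] := (cvg_at_right0P _ _).1 (valA x Ax) (e / (M + 1)) (divr_gt0 e0 M1).
  exists d => // h h0 /(hd h h0) hh.
  have -> : T h (T t x) = T t (T h x) by rewrite -!TD ?(ltW h0)// addrC.
  rewrite -linearB -linearZZ -linearB; apply: le_lt_trans (hM _) _.
  move: hh; rewrite ltr_pdivlMr//; apply: le_lt_trans.
  by rewrite mulrC ler_wpM2l// lerDl.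
have dTx : dom A (T t x) by rewrite domA; apply/cvg_ex; exists (T t (A x)).
split => //; exact: (cvg_unique (@norm_hausdorff _ _) (valA _ dTx) lim).
Qed.

Variables (iota : {linear X -> Y}) (b : R) (Rb : {linear X -> X}).
Hypotheses (hRb : is_resolvent A b Rb) (iotaE : forall x, `|iota x| = `|Rb x|).

(** Apply [T t] to [x = b Rb x - A (Rb x)] and use that it commutes with [A] on the domain. As the
    extrapolation norm of [x] is [|Rb x|], a bound for [T t] on [X] thereby holds with the same
    constant for that norm. *)
Lemma resolvent_semigroup (x : X) (t : R) : 0 <= t -> Rb (T t x) = T t (Rb x).
Proof.
move=> t0; have [_ RbP RbK] := hRb; have [dRb xE] := RbP x.
have [dTR ATR] := generator_semigroup t0 dRb.
by rewrite -[in LHS]xE linearB linearZ -ATR RbK.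
Qed.

(** If [Rb x = 0] then [x = b 0 - A 0]. The values of [A] come as a bare function, so [A 0 = 0] has
    to be read off from the difference quotients at 0. *)
Lemma iota_injective : injective iota.
Proof.
suff inj0 x : iota x = 0 -> x = 0.
  by move=> x y xy; apply/eqP; rewrite -subr_eq0; apply/eqP/inj0; rewrite linearB xy subrr.
move=> x0; have Rx0 : Rb x = 0 by apply/eqP; rewrite -normr_eq0 -iotaE x0 normr0.
have [_ RbP _] := hRb; have [dx <-] := RbP x; move: dx; rewrite Rx0 => d0.
have [_ /(_ 0 d0) lim0] := hA.
suff -> : A 0 = 0 by rewrite scaler0 subr0.
apply: (cvg_unique (@norm_hausdorff _ _) lim0).
rewrite (_ : (fun h => _) = fun _ => 0); first exact: cvg_cst.
by apply/funext => h; rewrite linear0 subr0 scaler0.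
Qed.

Lemma iota_bounded : exists2 c, 0 <= c & forall x, `|iota x| <= c * `|x|.
Proof.
have [cRb _ _] := hRb; have [c c0 hc] := continuous_linear_bound cRb.
by exists c => // x; rewrite iotaE.
Qed.

(* Since [x = b Rb x - A (Rb x)], the norm of [X] is recovered from difference
   quotients of [t |-> T t (Rb x)], each of which is bounded for the norm of
   the extrapolation space. *)
Definition resolvent_quotient (n : nat) (x : X) : R :=
  `|n.+1%:R *: (T n.+1%:R^-1 (Rb x) - Rb x)|.

Lemma resolvent_quotient_cvg (x : X) :
  resolvent_quotient n x @[n --> \oo] --> `|A (Rb x)|.
Proof.
have [_ RbP _] := hRb; have [dx _] := RbP x; have [_ /(_ _ dx) lim] := hA.
apply: cvg_norm; apply/cvgn_normP => e e0.
have [d d0 hd] := (cvg_at_right0P _ _).1 lim e e0.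
have [N Nd] := invn_lt d0; exists N => n Nn.
rewrite -[X in X *: _]invrK; apply: hd; first by rewrite invr_gt0.
by apply: le_lt_trans Nd; rewrite lef_pV2 ?posrE// ler_nat.
Qed.

Lemma resolvent_quotient_le (n : nat) :
  exists2 c, 0 <= c & forall x, resolvent_quotient n x <= c * `|iota x|.
Proof.
have [cT _ _ _] := hT; have n0 : 0 <= (n.+1%:R^-1 : R) by rewrite invr_ge0.
have [M M0 hM] := continuous_linear_bound (cT _ n0).
exists (n.+1%:R * (M + 1)) => [|x]; first by rewrite mulr_ge0// addr_ge0.
rewrite /resolvent_quotient normrZ ger0_norm// -mulrA ler_wpM2l// iotaE.
by apply: le_trans (ler_normB _ _) _; rewrite mulrDl mul1r lerD2r.
Qed.

Lemma resolvent_quotient_bounded (x : X) : exists c, forall n, resolvent_quotient n x <= c.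
Proof.
have /cvgn_normP lim := @resolvent_quotient_cvg x.
have [N hN] := lim 1 ltr01.
exists (\sum_(i < N) resolvent_quotient i x + (`|A (Rb x)| + 1)) => n.
have q0 i : 0 <= resolvent_quotient i x by exact: normr_ge0.
have [nN|Nn] := ltnP n N.
  rewrite (bigD1 (Ordinal nN))//= -addrA lerDl addr_ge0 ?sumr_ge0// addr_ge0//.
have := hN n Nn; rewrite ltr_distl => /andP[_ /ltW h].
by apply: le_trans h _; rewrite lerDr sumr_ge0.
Qed.

Lemma resolvent_quotient_norm (x : X) (c : R) :
  (forall n, resolvent_quotient n x <= c) -> `|x| <= c + `|b| * `|iota x|.
Proof.
move=> hc; have [_ RbP _] := hRb; have [_ xE] := RbP x.
have Ac : `|A (Rb x)| <= c.
  apply/ler_addgt0Pr => e e0.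
  have [N hN] := (cvgn_normP _ _).1 (@resolvent_quotient_cvg x) e e0.
  have := hN N (leqnn N); have := hc N.
  by rewrite ltr_distl => ? /andP[? _]; lra.
by rewrite -[in leLHS]xE iotaE -normrZ; apply: le_trans (ler_normB _ _) _; lra.
Qed.

Lemma resolvent_quotientD (n : nat) (x y : X) :
  resolvent_quotient n (x + y) <= resolvent_quotient n x + resolvent_quotient n y.
Proof.
rewrite /resolvent_quotient; apply: le_trans (ler_normD _ _).
by rewrite -scalerDr (linearD Rb) (linearD (T _)) opprD addrACA.
Qed.

Lemma resolvent_quotientZ (n : nat) (a : R) (x : X) :
  resolvent_quotient n (a *: x) = `|a| * resolvent_quotient n x.
Proof.
by rewrite /resolvent_quotient (linearZZ Rb) (linearZZ (T _)) -scalerBr scalerA mulrC -scalerA normrZ.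
Qed.

End semigroup.

Section orbits.
Context {R : realType} {Y : completeNormedModType R} (S : R -> {linear Y -> Y}) (M : R).
Hypotheses (hS : C0_semigroup S) (M0 : 0 <= M).
Hypothesis hM : forall t y, 0 <= t -> `|S t y| <= M * `|y|.

(** For [s <= t] the difference is [S s (S (t - s) y - y)], and the bound [M] is uniform in [s];
    only continuity at 0 remains. *)
Lemma orbit_uniformly_continuous (y : Y) (e : R) : 0 < e ->
  exists2 d, 0 < d & forall s t, 0 <= s -> 0 <= t -> `|s - t| < d -> `|S s y - S t y| < e.
Proof.
move=> e0; have [_ S0 SD /(_ y) /cvg_at_right0P lim] := hS.
have M1 : 0 < M + 1 by rewrite ltr_wpDl.
have [d d0 hd] := lim (e / (M + 1)) (divr_gt0 e0 M1).
have wlogst s t : 0 <= s -> s <= t -> `|t - s| < d -> `|S t y - S s y| < e.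
  move=> s0 st; rewrite ger0_norm ?subr_ge0// => tsd.
  have [->|ts] := eqVneq t s; first by rewrite subrr normr0.
  have ts0 : 0 < t - s by rewrite subr_gt0 lt_neqAle eq_sym ts.
  rewrite -[in S t](subrKC s t) SD//; last exact: ltW.
  rewrite -linearB; apply: le_lt_trans (hM _ s0) _.
  have := hd _ ts0 tsd; rewrite ltr_pdivlMr//; apply: le_lt_trans.
  by rewrite mulrC ler_wpM2l// lerDl.
exists d => // s t s0 t0 std; have [st|/ltW ts] := leP s t; last exact: wlogst.
by rewrite distrC; apply: wlogst => //; rewrite distrC.
Qed.

End orbits.

(** * The input map into the extrapolation space *)

Section control.
Context {R : realType} {X U Y : completeNormedModType R}.
Variables (A : operator X) (T : R -> {linear X -> X}).
Variables (iota : {linear X -> Y}) (Tm1 : R -> {linear Y -> Y}).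
Hypotheses (hT : C0_semigroup T) (hA : generates A T).
Hypotheses (hY : extrapolation_space A iota) (hTm1 : extended_semigroup iota T Tm1).
Local Notation mu := (@lebesgue_measure R).

(** The bound holds on the range of [iota] because [Rb] commutes with [T t], and density carries it
    to [Y]. A bound [K] for [Tm1 t], known from continuity alone, controls the approximation error
    and disappears in the limit. *)
Lemma extended_semigroup_bound (t M : R) : 0 <= t -> 0 <= M ->
  (forall x, `|T t x| <= M * `|x|) -> forall y, `|Tm1 t y| <= M * `|y|.
Proof.
move=> t0 M0 TM y; have [diota [b [Rb [hRb iotaE]]]] := hY.
have [[cTm1 _ _ _] TmE] := hTm1.
have Tiota x : `|Tm1 t (iota x)| <= M * `|iota x|.
  by rewrite TmE// !iotaE (resolvent_semigroup hT hA hRb).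
have [K K0 hK] := continuous_linear_bound (cTm1 t t0).
apply/ler_addgt0Pr => e e0.
have MK0 : 0 < M + K + 1 by rewrite ltr_wpDl// addr_ge0.
have [z [yx [x _ xE]]] : (ball y (e / (M + K + 1)) `&` range iota) !=set0.
  apply: diota; last exact: ball_open.
  by exists y; apply: ballxx; exact: divr_gt0.
move: yx; rewrite -xE -ball_normE /= ltr_pdivlMr// => yx.
rewrite -[in leLHS](subrK (iota x) y) linearD.
have h1 := ler_normD (Tm1 t (y - iota x)) (Tm1 t (iota x)).
have h2 := hK (y - iota x); have h3 := Tiota x.
have h4 : M * `|iota x| <= M * `|y| + M * `|y - iota x|.
  rewrite -mulrDr ler_wpM2l// -[in leLHS](subKr y (iota x)).
  exact: ler_normB.
have := normr_ge0 (y - iota x).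
by move: yx; rewrite !mulrDr mulr1 ![_ * M]mulrC ![_ * K]mulrC; lra.
Qed.

Variables (B : {linear U -> Y}) (M b : R).
Hypotheses (M0 : 0 <= M) (b0 : 0 <= b).
Hypothesis hM : forall t y, 0 <= t -> `|Tm1 t y| <= M * `|y|.
Hypothesis hb : forall v, `|B v| <= b * `|v|.

Lemma lebesgue_measure_itv_lty (a t : R) : (mu `]a, t[ < +oo)%E.
Proof. by rewrite lebesgue_measure_itv/= lte_fin; case: ifP => _; rewrite ?ltry. Qed.

Definition convolution_integrand (t : R) (u : R -> U) (s : R) : Y :=
  Tm1 (t - s) (B (u s)).

Definition input_map (t : R) (u : R -> U) : Y :=
  bochner_integral `]0, t[ (convolution_integrand t u).

(* [grid t n s / n.+1] is [t - s] rounded down to a multiple of [1 / n.+1]. *)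
Let grid (t : R) (n : nat) (s : R) : nat :=
  if s \in `]0%R, t[%classic then Num.truncn ((t - s) * n.+1%:R) else 0%N.

Let grid_finitely_valued t n : finitely_valued (grid t n).
Proof.
pose K := (Num.truncn (t * n.+1%:R)).+1.
apply: finitely_valuedI.
  apply: (@sub_finite_set _ _ `I_K.+1); last exact: finite_II.
  move=> _ [s _ <-] /=; rewrite /grid; case: ifPn => // /set_mem/=.
  rewrite in_itv/= => /andP[s0 st].
  rewrite ltnS (@leq_trans (Num.truncn (t * n.+1%:R)))//.
  by apply: le_truncn; rewrite ler_wpM2r// gerBl ltW.
move=> k.
rewrite (_ : _ @^-1` _ =
  (`]0%R, t[ `&` (fun s => (t - s) * n.+1%:R) @^-1` `[k%:R, k.+1%:R[) `|`
  (~` `]0%R, t[ `&` (fun=> k) @^-1` [set 0%N])).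
  apply: measurableU; apply: measurableI => //.
  - rewrite -[X in measurable X]setTI.
    have mf : measurable_fun setT (fun s : R => (t - s) * n.+1%:R).
      by apply: measurable_funM => //; exact: measurable_funB.
    exact: (mf measurableT _ (measurable_itv _)).
  - exact: measurableC.
  - by rewrite preimage_cst; case: ifP.
have tE s : `]0%R, t[%classic s ->
    (Num.truncn ((t - s) * n.+1%:R) == k) = (k%:R <= (t - s) * n.+1%:R < k.+1%:R).
  rewrite /= in_itv/= => /andP[s0 st].
  by apply: truncn_eq; rewrite mulr_ge0// subr_ge0 ltW.
apply/seteqP; split=> s /=; rewrite /grid.
  case: ifPn => [/set_mem Ds /eqP|/negP Ds <-].
    by rewrite tE// => h; left; split => //; rewrite in_itv.
  by right; split => // Ds'; apply: Ds; rewrite inE.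
move=> [[Ds h]|[Ds ->]]; last by rewrite memNset.
by rewrite mem_set//; apply/eqP; rewrite tE//; move: h; rewrite in_itv.
Qed.

(** Rounding the time [t - s] to the grid and replacing [u] by simple functions gives simple
    functions. Their error splits into the error of the input, controlled by the uniform bound
    [M * b], and the error in time along the fixed orbit of [B (u s)]. *)
Lemma convolution_integrand_measurable (t : R) (u : R -> U) :
  bochner_measurable `]0, t[ u ->
  bochner_measurable `]0, t[ (convolution_integrand t u).
Proof.
move=> [s_ ss su].
exists (fun n s => Tm1 ((grid t n s)%:R / n.+1%:R) (B (s_ n s))) => [n|].
  have /simple_funP sn := ss n.
  exact: (simple_fun_map (fun p => Tm1 (p.1%:R / n.+1%:R) (B p.2))
    (finitely_valued_pair (grid_finitely_valued t n) sn)).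
have [hTm _] := hTm1.
apply: filterS su => s + Ds => /(_ Ds) /cvgn_normP su.
apply/cvgn_normP => e e0; rewrite /convolution_integrand.
have e2 : 0 < e / 2 by rewrite divr_gt0.
have [d d0 hd] := orbit_uniformly_continuous hTm M0 hM (B (u s)) e2.
have Mb : 0 < M * b + 1 by rewrite ltr_wpDl// mulr_ge0.
have [N1 h1] := su _ (divr_gt0 e2 Mb).
have [N2 h2] := invn_lt d0.
exists (maxn N1 N2) => n; rewrite geq_max => /andP[n1 n2].
have := Ds; rewrite /= in_itv/= => /andP[s0 st].
have ts0 : 0 <= t - s by rewrite subr_ge0 ltW.
have n0 : (0 : R) < n.+1%:R by rewrite ltr0n.
have /andP[g1 g2] := truncn_itv (mulr_ge0 ts0 (ltW n0)).
set g := _ / _; have g0 : 0 <= g by rewrite divr_ge0.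
have gts : `|g - (t - s)| < d.
  apply: lt_trans h2 => //.
  have -> : `|g - (t - s)| = t - s - g.
    rewrite distrC ger0_norm// subr_ge0 /g /grid mem_set// ler_pdivrMr//.
  apply: (@lt_le_trans _ _ n.+1%:R^-1); last first.
    by rewrite lef_pV2 ?posrE ?ltr0n// ler_nat ltnS.
  rewrite ltrBlDr /g /grid mem_set// -[X in _ < X + _]mul1r -mulrDl ltr_pdivlMr//.
  by rewrite nat1r.
apply: le_lt_trans (ler_distD (Tm1 g (B (u s))) _ _) _.
rewrite (splitr e); apply: ltrD; last exact: hd.
rewrite -linearB -linearB; apply: le_lt_trans (hM _ g0) _.
have := h1 n n1; rewrite ltr_pdivlMr//; apply: le_lt_trans.
have h := ler_wpM2l M0 (hb (s_ n s - u s)); apply: le_trans h _.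
by rewrite mulrA mulrC ler_wpM2l// lerDl.
Qed.

Lemma convolution_integrand_L1 (t : R) (u : R -> U) :
  L1_mem `]0, t[ u -> L1_mem `]0, t[ (convolution_integrand t u) /\
  (eL1_norm `]0%R, t[ (convolution_integrand t u) <= (M * b)%:E * eL1_norm `]0%R, t[ u)%E.
Proof.
move=> [bu iu].
have h : (eL1_norm `]0%R, t[ (convolution_integrand t u) <=
    (M * b)%:E * eL1_norm `]0%R, t[ u)%E.
  apply: eL1_norm_le_scale => //; first exact: mulr_ge0.
  apply: nearW => s /=; rewrite in_itv/= => /andP[s0 st].
  rewrite /convolution_integrand.
  have ts : 0 <= t - s by rewrite subr_ge0 ltW.
  by apply: le_trans (hM _ ts) _; rewrite -mulrA ler_wpM2l.
split => //; split; first exact: convolution_integrand_measurable.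
by apply: le_lt_trans h _; rewrite lte_mul_pinfty// lee_fin mulr_ge0.
Qed.

Lemma input_map_lin (t a : R) (u v : R -> U) :
  L1_mem `]0, t[ u -> L1_mem `]0, t[ v ->
  input_map t (fun s => a *: u s + v s) = a *: input_map t u + input_map t v.
Proof.
move=> /convolution_integrand_L1[Lu _] /convolution_integrand_L1[Lv _].
rewrite /input_map -(bochner_integral_lin (measurable_itv _)
  (lebesgue_measure_itv_lty 0 t) a Lu Lv).
by apply: bochner_integral_eq => s _; rewrite /convolution_integrand !linearP.
Qed.

Lemma input_map_eq (t : R) (u v : R -> U) :
  (forall s, `]0, t[%classic s -> u s = v s) -> input_map t u = input_map t v.
Proof.
move=> uv; apply: bochner_integral_eq => s Ds.
by rewrite /convolution_integrand uv.
Qed.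

Lemma input_map_bound (t : R) (u : R -> U) : L1_mem `]0, t[ u ->
  (`|input_map t u|%:E <= (M * b)%:E * eL1_norm `]0%R, t[ u)%E.
Proof.
move=> /convolution_integrand_L1[L1c]; apply: le_trans.
exact: (ler_norm_bochner_integral (measurable_itv _) (lebesgue_measure_itv_lty 0 t)).
Qed.

Lemma L1_mem_shift (t a : R) (u : R -> U) : 0 <= a -> a <= t -> L1_mem `]0, t[ u ->
  L1_mem `]0, (t - a)[ (fun s => u (s + a)).
Proof.
move=> a0 at' Lu.
have sub : `]a, t[%classic `<=` `]0, t[%classic.
  by apply: subset_itvr; rewrite bnd_simp.
have := L1_mem_translation a (measurable_itv _) (L1_mem_subset sub Lu).
by rewrite itv_translation subrr.
Qed.

(** Cut the integral at [a]. Before [a], the operator at time [t - s] factors through time [a - s],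
    and the outer factor [Tm1 (t - a)] leaves the integral by boundedness; after [a], substitute
    [s + a] for [s]. *)
Lemma input_map_split (t a : R) (u : R -> U) : 0 <= a -> a <= t ->
  L1_mem `]0, t[ u ->
  input_map t u = Tm1 (t - a) (input_map a u) + input_map (t - a) (fun s => u (s + a)).
Proof.
move=> a0 at' Lu; have [hTm _] := hTm1; have [_ _ TD _] := hTm.
have [Lc _] := convolution_integrand_L1 Lu.
have sub1 : `]0, a[%classic `<=` `]0, t[%classic.
  by apply: subset_itvl; rewrite bnd_simp.
have sub2 : `]a, t[%classic `<=` `]0, t[%classic.
  by apply: subset_itvr; rewrite bnd_simp.
have muD C : measurable C ->
    mu (`]0%R, t[ `&` C) = (mu (`]0%R, a[ `&` C) + mu (`]a, t[ `&` C))%E.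
  move=> mC.
  have mI (c d : R) : measurable (`]c, d[%classic `&` C : set (measurableTypeR R)).
    exact: measurableI.
  have ma : measurable ([set a] `&` (`]0%R, t[%classic `&` C) : set (measurableTypeR R)).
    by apply: measurableI.
  have disj : (`]0%R, a[%classic `&` C) `&` (`]a, t[%classic `&` C) = set0.
    rewrite -subset0 => s [[/=]]; rewrite !in_itv/= => /andP[_ sa] _ [/andP[as' _] _].
    by have := lt_trans sa as'; rewrite ltxx.
  transitivity (mu ((`]0%R, a[%classic `&` C) `|` (`]a, t[%classic `&` C))); last first.
    by rewrite measureU//; exact: mI.
  (* The cut point belongs to neither open piece, but it is a null set. *)
  have a0' : mu ([set a] `&` (`]0%R, t[%classic `&` C)) = 0%E.
    apply/eqP; rewrite -measure_le0 -[leRHS](lebesgue_measure_set1 a).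
    by apply: le_measure; rewrite ?inE//.
  rewrite -[RHS](measureU0 (measurableU _ _ (mI _ _) (mI _ _)) ma a0').
  congr (mu _); apply/seteqP; split=> [s [Ds Cs]|s].
    have [as'|sa|->] := ltgtP a s.
    + left; right; split => //; move: Ds; rewrite /= !in_itv/= => /andP[_ ->].
      by rewrite as'.
    + left; left; split => //; move: Ds; rewrite /= !in_itv/= => /andP[-> _].
      by rewrite sa.
    + by right; split.
  by move=> [[[/sub1 ? ?]|[/sub2 ? ?]]|[_ ?]].
rewrite {1}/input_map (bochner_integral_additive (measurable_itv _) (measurable_itv _)
  (measurable_itv _) (lebesgue_measure_itv_lty 0 t) sub1 sub2 muD Lc).
congr (_ + _).
  have [L1a _] := convolution_integrand_L1 (L1_mem_subset sub1 Lu).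
  have ta0 : 0 <= t - a by rewrite subr_ge0.
  have [_ <-] := bochner_integral_linear (measurable_itv _)
    (lebesgue_measure_itv_lty 0 a) M0 (fun y => hM y ta0) L1a.
  apply: bochner_integral_eq => s /=; rewrite in_itv/= => /andP[s0 sa].
  rewrite /convolution_integrand -TD// ?subr_ge0 1?ltW//.
  by rewrite addrA subrK.
rewrite -(bochner_integral_translation a (measurable_itv _)
  (lebesgue_measure_itv_lty a t) (L1_mem_subset sub2 Lc)).
rewrite itv_translation subrr; apply: bochner_integral_eq => s _ /=.
rewrite /convolution_integrand; congr (Tm1 _ _); ring.
Qed.

End control.

(** * Completeness of L^1 along simple functions *)

Section L1_real.
Context {R : realType} (V : completeNormedModType R).
Local Notation mu := (@lebesgue_measure R).
Variables (D : set R) (mD : measurable D).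
Implicit Types f g h : R -> V.

Lemma L1_norm_ge0 f : 0 <= L1_norm D f.
Proof. by apply: fine_ge0; exact: eL1_norm_ge0. Qed.

Lemma L1_memB f g : L1_mem D f -> L1_mem D g -> L1_mem D (fun x => f x - g x).
Proof.
move=> Lf Lg; have := L1_mem_lin (-1) mD Lg Lf.
by congr L1_mem; apply/funext => x; rewrite scaleN1r addrC.
Qed.

Lemma L1_memD f g : L1_mem D f -> L1_mem D g -> L1_mem D (fun x => f x + g x).
Proof.
move=> Lf Lg; have := L1_mem_lin 1 mD Lf Lg.
by congr L1_mem; apply/funext => x; rewrite scale1r.
Qed.

Lemma L1_mem0 : L1_mem D (fun _ => 0 : V).
Proof.
split; first exact: bochner_measurable_cst.
by rewrite integral0_eq// => x _; rewrite normr0.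
Qed.

Lemma L1_memZ a f : L1_mem D f -> L1_mem D (fun x => a *: f x).
Proof.
move=> Lf; have := L1_mem_lin a mD Lf L1_mem0.
by congr L1_mem; apply/funext => x; rewrite addr0.
Qed.

Lemma L1_normD f g : L1_mem D f -> L1_mem D g ->
  L1_norm D (fun x => f x + g x) <= L1_norm D f + L1_norm D g.
Proof.
move=> Lf Lg; rewrite -lee_fin EFinD -!eL1_normE//; last exact: L1_memD.
by apply: eL1_normD => //; [case: Lf|case: Lg].
Qed.

Lemma L1_normZ a f : L1_mem D f ->
  L1_norm D (fun x => a *: f x) = `|a| * L1_norm D f.
Proof.
move=> Lf; apply: EFin_inj; rewrite EFinM -!eL1_normE//; last exact: L1_memZ.
by apply: eL1_normZ => //; case: Lf.
Qed.

Lemma L1_norm_distC f g :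
  L1_norm D (fun x => f x - g x) = L1_norm D (fun x => g x - f x).
Proof. by congr fine; apply: eq_integral => x _; rewrite distrC. Qed.

Lemma L1_norm_dist h f g : L1_mem D f -> L1_mem D g -> L1_mem D h ->
  L1_norm D (fun x => f x - g x) <=
  L1_norm D (fun x => f x - h x) + L1_norm D (fun x => h x - g x).
Proof.
move=> Lf Lg Lh; have := L1_normD (L1_memB Lf Lh) (L1_memB Lh Lg).
by congr (L1_norm _ _ <= _); apply/funext => x; rewrite subrKA.
Qed.

Section fast_cauchy.
Variables (S_ : nat -> R -> V) (delta : nat -> R).
Hypotheses (sS : forall k, simple_fun (S_ k)) (d0 : forall k, 0 <= delta k).
Hypothesis d2 : forall k, delta k.+1 <= delta k / 2.
Hypothesis hS : forall k, (eL1_norm D (fun x => S_ k.+1 x - S_ k x)%R <= (delta k)%:E)%E.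

Let d k x : \bar R := `|S_ k.+1 x - S_ k x|%:E.

Let d_ge0 k x : (0 <= d k x)%E.
Proof. by rewrite lee_fin. Qed.

Let sum_d_ge0 x : (0 <= \sum_(k <oo) d k x)%E.
Proof. by apply: nneseries_ge0. Qed.

Let measurable_d k : measurable_fun D (d k).
Proof.
apply/measurable_EFinP; have := strongly_measurable_norm (D := D)
  (simple_strongly_measurable (simple_fun_lin (-1) (sS k) (sS k.+1))).
by congr measurable_fun; apply/funext => x; rewrite scaleN1r addrC.
Qed.

Let int_d : (\int[mu]_(x in D) (\sum_(k <oo) d k x) <= (2 * delta 0%N)%:E)%E.
Proof.
rewrite integral_nneseries//.
apply: lime_le; first by apply: is_cvg_nneseries => k _ _; exact: eL1_norm_ge0.
apply: nearW => n.
have : (\sum_(0 <= k < n) \int[mu]_(x in D) d k x <=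
    (\sum_(0 <= k < n) delta k)%:E)%E.
  by rewrite -sumEFin; apply: lee_sum => k _; exact: hS.
move=> /le_trans; apply; rewrite lee_fin.
(* Adding [2 * delta n], a bound for the remaining tail, makes the inequality inductive. *)
suff : \sum_(0 <= k < n) delta k + 2 * delta n <= 2 * delta 0%N.
  by apply: le_trans; rewrite lerDl mulr_ge0.
elim: n => [|n IHn]; first by rewrite big_geq// add0r.
rewrite big_nat_recr//=; have := d2 n; move: IHn; lra.
Qed.

Let finite_d : {ae mu, forall x, D x -> (\sum_(k <oo) d k x < +oo)%E}.
Proof.
have md : measurable_fun D (fun x => \sum_(k <oo) d k x)%E.
  exact: ge0_emeasurable_sum.
have id : mu.-integrable D (fun x => \sum_(k <oo) d k x)%E.
  apply/integrableP; split => //.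
  under eq_integral do rewrite gee0_abs//.
  exact: le_lt_trans int_d (ltry _).
have := @integrable_ae _ (measurableTypeR R) R mu D mD _ id.
by apply: filterS => x + Dx => /(_ Dx); rewrite ge0_fin_numE.
Qed.

Let dist_S x n : (`|S_ n x - S_ 0%N x|%:E <= \sum_(k <oo) d k x)%E.
Proof.
apply: le_trans (@nneseries_lim_ge _ (fun k => d k x) xpredT 0%N n _) => //.
rewrite sumEFin lee_fin -(@telescope_sumr _ _ _ (fun k => S_ k x))//.
exact: ler_norm_sum.
Qed.

Let cvg_S x : (\sum_(k <oo) d k x < +oo)%E -> cvgn (fun n => S_ n x).
Proof.
move=> fx.
have : cvgn (series (fun k => S_ k.+1 x - S_ k x)).
  apply: normed_cvg.
  apply: nondecreasing_is_cvgn.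
    apply/nondecreasing_seqP => n.
    by rewrite /normed_series_of /series/= big_nat_recr//= lerDl.
  exists (fine (\sum_(k <oo) d k x)) => _ [n _ <-].
  rewrite -lee_fin fineK; last first.
    by rewrite ge0_fin_numE.
  rewrite /series/= -sumEFin.
  exact: nneseries_lim_ge.
move=> /cvg_ex[l hl]; apply/cvg_ex; exists (l + S_ 0%N x).
rewrite (_ : (fun n => S_ n x) =
    (fun n => series (fun k => S_ k.+1 x - S_ k x) n + S_ 0%N x)).
  by apply: cvgD => //; exact: cvg_cst.
by apply/funext => n; rewrite /series/= telescope_sumr// subrK.
Qed.

(** The sum of the norms of the increments has integral at most [2 * delta 0], hence is finite
    almost everywhere; there the telescoping series converges absolutely. *)
Lemma fast_cauchy_limit : exists2 w : R -> V, bochner_measurable D w &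
  {ae mu, forall x, D x -> S_ n x @[n --> \oo] --> w x}.
Proof.
have h : {ae mu, forall x, D x -> S_ n x @[n --> \oo] --> limn (S_ ^~ x)}.
  by apply: filterS finite_d => x + Dx => /(_ Dx) /cvg_S.
by exists (fun x => limn (S_ ^~ x)) => //; exists S_.
Qed.

Lemma fast_cauchy_dist (w : R -> V) :
  {ae mu, forall x, D x -> S_ n x @[n --> \oo] --> w x} ->
  (eL1_norm D (fun x => w x - S_ 0%N x)%R <= (2 * delta 0%N)%:E)%E.
Proof.
move=> hw; apply: le_trans int_d; apply: ge0_ae_le_integral => //.
apply: filterS hw => x + Dx => /(_ Dx) /cvgn_normP lim.
apply/lee_addgt0Pr => e e0; have [N hN] := lim e e0.
have h := ler_distD (S_ N x) (w x) (S_ 0%N x).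
apply: (@le_trans _ _ (`|S_ N x - S_ 0%N x| + e)%:E).
  by have := hN N (leqnn N); rewrite lee_fin distrC => /ltW; lra.
by rewrite EFinD leeD2r.
Qed.

End fast_cauchy.

(** The distance from the limit to the first term is at most [2 * delta 0]; the same estimate for
    the sequence started at index [k] gives the bound for every [k]. *)
Lemma L1_fast_cauchy (S_ : nat -> R -> V) (delta : nat -> R) :
  (mu D < +oo)%E ->
  (forall k, simple_fun (S_ k)) -> (forall k, 0 <= delta k) ->
  (forall k, delta k.+1 <= delta k / 2) ->
  (forall k, L1_norm D (fun x => S_ k.+1 x - S_ k x) <= delta k) ->
  exists2 w, L1_mem D w & forall k, L1_norm D (fun x => w x - S_ k x) <= 2 * delta k.
Proof.
move=> finD sS d0 d2 hS.
have LS k : L1_mem D (S_ k) by exact: L1_mem_simple.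
have ehS k : (eL1_norm D (fun x => S_ k.+1 x - S_ k x)%R <= (delta k)%:E)%E.
  by rewrite eL1_normE ?lee_fin//; exact: L1_memB.
have [w bw hw] := fast_cauchy_limit sS d0 d2 ehS.
have dist k : (eL1_norm D (fun x => w x - S_ k x)%R <= (2 * delta k)%:E)%E.
  have := @fast_cauchy_dist (fun n => S_ (n + k)%N) (fun n => delta (n + k)%N).
  apply => // [n|n|]; [exact: d2|exact: ehS|].
  by apply: filterS hw => x + Dx => /(_ Dx); rewrite -[X in X -> _](cvg_shiftn k).
have Lw : L1_mem D w.
  have : L1_mem D (fun x => w x - S_ 0%N x).
    split; last exact: le_lt_trans (dist 0%N) (ltry _).
    by apply: bochner_measurableB => //; case: (LS 0%N).
  move=> /L1_memD /(_ (LS 0%N)).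
  by congr L1_mem; apply/funext => x; rewrite subrK.
exists w => // k; rewrite -lee_fin -eL1_normE//.
exact: L1_memB.
Qed.

End L1_real.

(** * Uniform boundedness of the input map *)

Section admissibility.
Context {R : realType} {X U Y : completeNormedModType R}.
Variables (A : operator X) (T : R -> {linear X -> X}).
Variables (iota : {linear X -> Y}) (Tm1 : R -> {linear Y -> Y}).
Variables (B : {linear U -> Y}) (M b : R).
Hypotheses (hT : C0_semigroup T) (hA : generates A T).
Hypotheses (hY : extrapolation_space A iota) (hTm1 : extended_semigroup iota T Tm1).
Hypotheses (M0 : 0 <= M) (b0 : 0 <= b).
Hypothesis hM : forall t y, 0 <= t -> `|Tm1 t y| <= M * `|y|.
Hypothesis hb : forall v, `|B v| <= b * `|v|.
Local Notation mu := (@lebesgue_measure R).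
Local Notation Xi := (input_map Tm1 B).

Local Opaque input_map.

Lemma extrapolation_injective : injective iota.
Proof.
by have [_ [b' [Rb [hRb iE]]]] := hY; exact: (@iota_injective _ _ _ _ _ hA _ _ _ hRb iE).
Qed.

Lemma ler_norm_input_map (t : R) (u : R -> U) : L1_mem `]0, t[ u ->
  `|Xi t u| <= M * b * L1_norm `]0, t[ u.
Proof.
move=> Lu; rewrite -lee_fin EFinM -eL1_normE//.
exact: (input_map_bound hTm1 M0 b0 hM hb Lu).
Qed.

Lemma input_mapB (t : R) (u v : R -> U) : L1_mem `]0, t[ u -> L1_mem `]0, t[ v ->
  Xi t (fun s => u s - v s) = Xi t u - Xi t v.
Proof.
move=> Lu Lv; transitivity ((-1) *: Xi t v + Xi t u); last by rewrite scaleN1r addrC.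
rewrite -(input_map_lin hTm1 M0 b0 hM hb (-1) Lv Lu).
by apply: input_map_eq => s _; rewrite scaleN1r addrC.
Qed.

Lemma input_map0 (t : R) : Xi t (fun _ => 0) = 0.
Proof.
have L0 : L1_mem `]0, t[ (fun _ : R => 0 : U) by exact: L1_mem0.
rewrite -(subrr (Xi t (fun _ => 0))) -(input_mapB L0 L0).
by apply: input_map_eq => s _; rewrite subr0.
Qed.

Lemma input_mapZ (t a : R) (u : R -> U) : L1_mem `]0, t[ u ->
  Xi t (fun s => a *: u s) = a *: Xi t u.
Proof.
move=> Lu; have L0 : L1_mem `]0, t[ (fun _ : R => 0 : U) by exact: L1_mem0.
rewrite -[RHS]addr0 -(input_map0 t) -(input_map_lin hTm1 M0 b0 hM hb a Lu L0).
by apply: input_map_eq => s _; rewrite addr0.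
Qed.

Definition admissible_on (t C : R) (Z : set (R -> U)) : Prop :=
  forall u, Z u -> exists2 x, iota x = Xi t u & `|x| <= C * L1_norm `]0, t[ u.

(** Differences of simple inputs are simple, so the states reached by simple approximants of [u]
    form a Cauchy sequence in [X]. Its limit is the state reached by [u], since [iota] and the input
    map are both continuous into [Y], the latter for the L^1-norm. *)
Lemma admissible_simple_L1 (t C : R) : 0 <= C ->
  admissible_on t C (@simple_fun R U) -> admissible_on t C (L1_mem `]0, t[).
Proof.
move=> C0 adm u Lu.
have mD : measurable (`]0, t[%classic : set R) by exact: measurable_itv.
have finD := lebesgue_measure_itv_lty 0 t.
have Ls (s : R -> U) : simple_fun s -> L1_mem `]0, t[ s by exact: L1_mem_simple.
have [s_ ss su] : exists2 s_ : nat -> R -> U, (forall n, simple_fun (s_ n)) &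
    forall e, 0 < e -> exists N, forall n, (N <= n)%N ->
      L1_norm `]0, t[ (fun x => u x - s_ n x) < e.
  have [s_ ss s0] := L1_simple_approx mD Lu; exists s_ => // e e0.
  have [N hN] := cvge0_lt s0 e0; exists N => n Nn.
  by rewrite -lte_fin -eL1_normE; [exact: hN|apply: L1_memB => //; exact: Ls].
have /choice[x_ xE] n : exists x, iota x = Xi t (s_ n) /\
    `|x| <= C * L1_norm `]0, t[ (s_ n).
  by have [x] := adm _ (ss n); exists x.
have xB n m : `|x_ n - x_ m| <= C * L1_norm `]0, t[ (fun x => s_ n x - s_ m x).
  have ssnm : simple_fun (fun x => s_ n x - s_ m x).
    have := simple_fun_lin (-1) (ss m) (ss n).
    by congr simple_fun; apply/funext => x; rewrite scaleN1r addrC.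
  have [x xnm] := adm _ ssnm; suff -> : x_ n - x_ m = x by [].
  apply: extrapolation_injective; rewrite linearB xnm input_mapB; [|exact: Ls..].
  by rewrite (xE n).1 (xE m).1.
have C1 : 0 < C + 1 by rewrite ltr_wpDl.
have [x xl] : exists x : X, x_ n @[n --> \oo] --> x.
  apply: cauchy_cvgn => e e0.
  have e2 : 0 < e / (C + 1) / 2 by rewrite !divr_gt0.
  have [N hN] := su _ e2; exists N => n Nn.
  apply: le_lt_trans (xB n N) _.
  have h := L1_norm_dist mD (Ls _ (ss n)) (Ls _ (ss N)) Lu.
  have := hN n Nn; have := hN N (leqnn N); rewrite (L1_norm_distC _ _ (s_ n)) => hn hm.
  have : L1_norm `]0, t[ (fun x => s_ n x - s_ N x) < e / (C + 1).
    by move: h hn hm; lra.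
  rewrite ltr_pdivlMr// mulrC; apply: le_lt_trans.
  by rewrite ler_wpM2r ?lerDl//; exact: L1_norm_ge0.
exists x.
  apply: (@limn_unique _ _ (fun n => iota (x_ n))).
    have [_ [b' [Rb [hRb iE]]]] := hY; have [c c0 hc] := iota_bounded hRb iE.
    apply/cvgn_normP => e e0.
    have c1 : 0 < c + 1 by rewrite ltr_wpDl.
    have [N hN] := (cvgn_normP _ _).1 xl _ (divr_gt0 e0 c1).
    exists N => n /hN; rewrite ltr_pdivlMr// -linearB; apply: le_lt_trans.
    by apply: le_trans (hc _) _; rewrite mulrC ler_wpM2l// lerDl.
  apply/cvgn_normP => e e0.
  have K1 : 0 < M * b + 1 by rewrite ltr_wpDl// mulr_ge0.
  have [N hN] := su _ (divr_gt0 e0 K1).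
  exists N => n /hN; rewrite ltr_pdivlMr// (xE n).1 distrC -input_mapB//; last exact: Ls.
  apply: le_lt_trans; apply: le_trans (ler_norm_input_map (L1_memB mD Lu (Ls _ (ss n)))) _.
  by rewrite mulrC ler_wpM2l ?lerDl//; exact: L1_norm_ge0.
apply/ler_addgt0Pr => e e0.
have e2 : 0 < e / 2 by rewrite divr_gt0.
have [N1 h1] := (cvgn_normP _ _).1 xl _ e2.
have [N2 h2] := su _ (divr_gt0 e2 C1).
pose n := maxn N1 N2.
have {}h1 := h1 n (leq_maxl _ _); have {}h2 := h2 n (leq_maxr _ _).
have h3 : `|x| <= `|x_ n - x| + `|x_ n|.
  by rewrite distrC -[in leLHS](subrK (x_ n) x) ler_normD.
have h4 : L1_norm `]0, t[ (s_ n) <=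
    L1_norm `]0, t[ u + L1_norm `]0, t[ (fun x => u x - s_ n x).
  have := L1_normD mD Lu (L1_memB mD (Ls _ (ss n)) Lu).
  rewrite (L1_norm_distC _ (s_ n)); congr (L1_norm _ _ <= _).
  by apply/funext => y; rewrite addrC subrK.
have h5 := ler_wpM2l C0 h4; have h6 := (xE n).2.
move: h2; rewrite ltr_pdivlMr// mulrDr mulr1 mulrC => h2.
have h7 := L1_norm_ge0 `]0, t[ (fun x => u x - s_ n x).
by move: h5; rewrite mulrDr; lra.
Qed.

(* A sliding-hump argument: the quotients [resolvent_quotient n] of the states
   reached by all of [L1] are pointwise bounded, and each is continuous on [L1];
   if they were not uniformly bounded on simple functions, a sum of small simple
   functions would reach a state on which they are unbounded. *)
Lemma admissible_simple (t : R) :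
  (forall u, L1_mem `]0, t[ u -> exists x, iota x = Xi t u) ->
  exists2 C, 0 <= C & admissible_on t C (@simple_fun R U).
Proof.
move=> reach.
have mD : measurable (`]0, t[%classic : set R) by exact: measurable_itv.
have finD := lebesgue_measure_itv_lty 0 t.
have Ls (s : R -> U) : simple_fun s -> L1_mem `]0, t[ s by exact: L1_mem_simple.
have [dY [b' [Rb [hRb iE]]]] := hY.
have /choice[F FE] u : exists x, L1_mem `]0, t[ u -> iota x = Xi t u.
  have [/reach[x xE]|nLu] := pselect (L1_mem `]0, t[ u); first by exists x.
  by exists 0 => /nLu.
pose q n u := resolvent_quotient T Rb n (F u).
pose N (u : R -> U) := L1_norm `]0, t[ u.
have N_ge0 u : 0 <= N u by exact: L1_norm_ge0.
have q_ge0 n u : 0 <= q n u by exact: normr_ge0.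
have Fsub u v : L1_mem `]0, t[ u -> L1_mem `]0, t[ v ->
    F u = F v + F (fun x => u x - v x).
  move=> Lu Lv; apply: extrapolation_injective; rewrite (linearD iota).
  by rewrite (FE u Lu) (FE v Lv) (FE _ (L1_memB mD Lu Lv)) (input_mapB Lu Lv) subrKC.
have qsub n u v : L1_mem `]0, t[ u -> L1_mem `]0, t[ v ->
    q n u <= q n v + q n (fun x => u x - v x).
  by move=> Lu Lv; rewrite /q (Fsub u v)//; exact: resolvent_quotientD.
have qZ n a u : L1_mem `]0, t[ u -> q n (fun x => a *: u x) = `|a| * q n u.
  move=> Lu; rewrite /q -resolvent_quotientZ; congr resolvent_quotient.
  apply: extrapolation_injective; rewrite (linearZZ iota).
  by rewrite (FE u Lu) (FE _ (L1_memZ mD a Lu)) (input_mapZ _ Lu).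
have /choice[c hc] n : exists c, 0 <= c /\
    forall u, L1_mem `]0, t[ u -> q n u <= c * N u.
  have [c c0 hc] := resolvent_quotient_le hT iE n.
  exists (c * (M * b)); split; first by rewrite !mulr_ge0.
  move=> u Lu; apply: le_trans (hc _) _; rewrite FE// -mulrA ler_wpM2l//.
  exact: ler_norm_input_map.
have qbdd u : exists K, forall n, q n u <= K.
  by have := resolvent_quotient_bounded hA hRb (F u); apply.
have [[C hC]|nC] := pselect (exists C, forall n s, simple_fun s -> q n s <= C * N s).
  (* The quotients control only [A (Rb x)]; the second summand pays for the term [b' Rb x] of [x],
     through the bound of the input map in [Y]. *)
  exists (`|C| + `|b'| * (M * b)); first by rewrite addr_ge0// !mulr_ge0.
  move=> s ss; exists (F s); first exact/FE/Ls.
  apply: le_trans (resolvent_quotient_norm hA hRb iE (c := `|C| * N s) _) _.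
    move=> n; apply: le_trans (hC n s ss) _.
    by rewrite ler_wpM2r// ler_norm.
  rewrite mulrDl lerD2l -mulrA ler_wpM2l// FE; last exact: Ls.
  exact/ler_norm_input_map/Ls.
exfalso.
(* Failure of the constant [L / d] yields [n] and [s]; rescaling [s] so that its quotient equals [L]
   makes its norm at most [d]. *)
have hump d L : 0 < d -> 0 < L -> exists n s, simple_fun s /\ N s <= d /\ L <= q n s.
  move=> d0 L0.
  have [n [s [ss qs]]] : exists n s, simple_fun s /\ (L / d) * N s < q n s.
    apply: contrapT => h; apply: nC; exists (L / d) => n s ss.
    by rewrite leNgt; apply/negP => h'; apply: h; exists n, s.
  have q0 : 0 < q n s by apply: le_lt_trans qs; rewrite mulr_ge0// divr_ge0// ltW.
  exists n, (fun x => L / q n s *: s x); split; [|split].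
  - have := simple_fun_lin (L / q n s) ss (simple_fun_cst 0).
    by congr simple_fun; apply/funext => x; rewrite addr0.
  - rewrite /N L1_normZ//; last exact: Ls.
    rewrite ger0_norm; last by rewrite divr_ge0// ltW.
    rewrite mulrAC ler_pdivrMr// -ler_pdivrMl// mulrA [_^-1 * _]mulrC.
    exact: ltW.
  - rewrite qZ; last exact: Ls.
    by rewrite ger0_norm ?divfK ?gt_eqF// divr_ge0// ltW.
pose state := {p : (R -> U) * R | simple_fun p.1 /\ 0 < p.2}.
(* A state is a partial sum with a radius. The new radius is so small that every input within twice
   that distance of the new sum has some quotient at least [k]. *)
have step (kp : nat * state) : exists p' : state,
    [/\ (sval p').2 <= (sval kp.2).2 / 2,
        N (fun x => (sval p').1 x - (sval kp.2).1 x) <= (sval kp.2).2 &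
        forall w, L1_mem `]0, t[ w -> N (fun x => w x - (sval p').1 x) <= 2 * (sval p').2 ->
          exists n, kp.1%:R <= q n w].
  case: kp => k [[S d] [/= sS d0]].
  have [K hK] := qbdd S.
  (* The height of the hump allows for a loss of [K] to the earlier humps [S] and of 1 to the later
     ones, leaving [k]. *)
  have L0 : 0 < k%:R + `|K| + 1 :> R by rewrite ltr_wpDl// addr_ge0.
  have [n [s [ss [Ns qs]]]] := hump _ _ d0 L0.
  have [cn0 hcn] := hc n.
  (* Halving gives rapid convergence; with the second term, a perturbation of norm at most [2 * d']
     changes the quotient of index [n] by at most [c n / (c n + 1)], which is below 1. *)
  pose d' := Num.min (d / 2) (2^-1 / (c n + 1)).
  have cn1 : 0 < c n + 1 by rewrite ltr_wpDl.
  have d'0 : 0 < d' by rewrite lt_min !divr_gt0// invr_gt0.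
  have sS' : simple_fun (fun x => S x + s x).
    have := simple_fun_lin 1 sS ss.
    by congr simple_fun; apply/funext => x; rewrite scale1r.
  exists (exist _ ((fun x => S x + s x), d') (conj sS' d'0)); split => /=.
  - by rewrite /d' ge_min lexx.
  - by rewrite (_ : (fun x => _) = s)//; apply/funext => x; rewrite addrC addKr.
  - move=> w Lw Nw; exists n.
    have h1 : q n s <= q n (fun x => S x + s x) + q n S.
      have := qsub n s (fun x => S x + s x) (Ls _ ss) (Ls _ sS').
      have := qZ n (-1) S (Ls _ sS); rewrite normrN1 mul1r => <-.
      congr (_ <= _ + q n _); apply/funext => x.
      by rewrite opprD addrCA subrr addr0 scaleN1r.
    have h2 : q n (fun x => S x + s x) <= q n w + q n (fun x => w x - (S x + s x)).
      have := qsub n (fun x => S x + s x) w (Ls _ sS') Lw.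
      have Lwd := L1_memB mD Lw (Ls _ sS').
      have := qZ n (-1) _ Lwd; rewrite normrN1 mul1r => <-.
      congr (_ <= _ + q n _); apply/funext => x.
      by rewrite scaleN1r opprB.
    have h3 : q n (fun x => w x - (S x + s x)) <= 1.
      apply: le_trans (hcn _ (L1_memB mD Lw (Ls _ sS'))) _.
      have h : N (fun x => w x - (S x + s x)) <= (c n + 1)^-1.
        apply: le_trans Nw _; rewrite mulrC -ler_pdivlMr// mulrC.
        by rewrite /d' ge_min lexx orbT.
      apply: le_trans (ler_wpM2l cn0 h) _.
      by rewrite ler_pdivrMr// mul1r lerDl.
    have := hK n; have := ler_norm K; lra.
have [next hnext] := choice step.
have s0 : simple_fun ((fun _ => 0 : U), 1 : R).1 /\ (0 : R) < ((fun _ : R => 0 : U), 1 : R).2.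
  by split => //=; exact: simple_fun_cst.
pose p := fix p k : state := if k is k'.+1 then next (k', p k') else exist _ _ s0.
pose S k := (sval (p k)).1; pose d k := (sval (p k)).2.
have [w Lw hw] : exists2 w, L1_mem `]0, t[ w & forall k, N (fun x => w x - S k x) <= 2 * d k.
  apply: L1_fast_cauchy => //.
  - by move=> k; have [] := svalP (p k).
  - by move=> k; have [_ /ltW] := svalP (p k).
  - by move=> k; have [] := hnext (k, p k).
  - by move=> k; have [] := hnext (k, p k).
have [K hK] := qbdd w.
(* At a step of index above [K], the limit input [w] has a quotient exceeding its own bound [K]. *)
have [_ _ /(_ w Lw (hw _.+1)) [n hn]] := hnext ((Num.truncn K).+1, p (Num.truncn K).+1).
have := le_trans hn (hK n); rewrite leNgt => /negP; apply.
exact: truncnS_gt.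
Qed.

End admissibility.

Lemma eL1_norm_support (R : realType) (V : normedModType R) (D E : set R) (f : R -> V) :
  E `<=` D -> (forall x, D x -> ~ E x -> f x = 0) -> eL1_norm D f = eL1_norm E f.
Proof.
move=> ED f0; rewrite /eL1_norm [LHS]integral_mkcond [RHS]integral_mkcond.
apply: eq_integral => x _; rewrite /patch.
have [Ex|nEx] := pselect (E x); first by rewrite !mem_set//; exact: ED.
rewrite (memNset nEx); case: ifPn => // /set_mem Dx.
by rewrite f0// normr0.
Qed.

(** * From one period of length tau to all times *)

Section horizons.
Context {R : realType} {X U Y : completeNormedModType R}.
Variable T : R -> {linear X -> X}.
Variables (iota : {linear X -> Y}) (Tm1 : R -> {linear Y -> Y}).
Variables (B : {linear U -> Y}) (M b : R).
Hypotheses (hTm1 : extended_semigroup iota T Tm1).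
Hypotheses (M0 : 0 <= M) (b0 : 0 <= b).
Hypothesis hM : forall t y, 0 <= t -> `|Tm1 t y| <= M * `|y|.
Hypothesis hb : forall v, `|B v| <= b * `|v|.
Local Notation mu := (@lebesgue_measure R).
Local Notation Xi := (input_map Tm1 B).

Local Opaque input_map.

Lemma L1_norm_shift (t a : R) (u : R -> U) : L1_mem `]a, t[ u ->
  L1_norm `]0, (t - a)[ (fun s => u (s + a)) = L1_norm `]a, t[ u.
Proof.
move=> [bu _]; congr fine.
by have := eL1_norm_translation a (measurable_itv _) bu; rewrite itv_translation subrr.
Qed.

(* An input on [0, t[ is delayed to the end of the longer interval [0, tau[. *)
Lemma admissible_simple_le (tau t C : R) : 0 <= t -> t <= tau ->
  admissible_on iota Tm1 B tau C (@simple_fun R U) ->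
  admissible_on iota Tm1 B t C (@simple_fun R U).
Proof.
move=> t0 ttau adm s ss.
pose a := tau - t; have a0 : 0 <= a by rewrite subr_ge0.
have ata : a <= tau by rewrite gerBl.
have taua : tau - a = t by rewrite /a subKr.
pose s' r := if r \in `]a, tau[%classic then s (r + - a) else 0.
have ss' : simple_fun s'.
  have /simple_funP fsa := simple_fun_translation (- a) ss.
  exact: (simple_fun_map (fun p : U * bool => if p.2 then p.1 else 0)
    (finitely_valued_pair fsa (finitely_valued_indicator (measurable_itv `]a, tau[)))).
have Ls (v : R -> U) (c d : R) : simple_fun v -> L1_mem `]c, d[ v.
  by move=> sv; apply: L1_mem_simple => //; exact: lebesgue_measure_itv_lty.
have s's r : `]0, t[%classic r -> s' (r + a) = s r.
  rewrite /= in_itv/= => /andP[r0 rt]; rewrite /s' mem_set ?addrK//=.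
  by rewrite in_itv/= ltrDr r0/= -ltrBrDr taua.
have XiE : Xi tau s' = Xi t s.
  rewrite (input_map_split hTm1 M0 b0 hM hb a0 ata (Ls _ _ _ ss')) taua.
  rewrite (@input_map_eq _ _ _ Tm1 B a s' (fun _ => 0)); last first.
    move=> r /=; rewrite in_itv/= => /andP[_ ra].
    by rewrite /s' memNset//= in_itv/= ltNge (ltW ra).
  rewrite (input_map0 hTm1 M0 b0 hM hb) linear0 add0r.
  exact: input_map_eq.
have NE : L1_norm `]0, tau[ s' = L1_norm `]0, t[ s.
  transitivity (L1_norm `]a, tau[ s').
    congr fine; apply: eL1_norm_support; first by apply: subset_itvr; rewrite bnd_simp.
    by move=> x _ nx; rewrite /s' memNset.
  rewrite -L1_norm_shift ?taua; last exact: Ls.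
  by congr fine; apply: eL1_norm_eq.
by have [x xE xle] := adm s' ss'; exists x; rewrite -?XiE -?NE.
Qed.

(** Induction on the number of periods, splitting at [t - tau]: the last window contributes at most
    [C * K], and the earlier state, at most [2 * C * K], is halved by [T tau]. The factor 2 is the
    sum of the geometric series of ratio 1/2. *)
Lemma admissible_infinite_time (tau C : R) : 0 < tau -> 0 <= C ->
  (forall x, `|T tau x| <= 2^-1 * `|x|) ->
  (forall t, 0 <= t -> t <= tau -> admissible_on iota Tm1 B t C (L1_mem `]0, t[)) ->
  forall t u K, 0 <= t -> L1_mem `]0, t[ u ->
    (forall a c, 0 <= a -> a <= c -> c <= t -> c <= a + tau -> L1_norm `]a, c[ u <= K) ->
    exists2 x, iota x = Xi t u & `|x| <= 2 * C * K.
Proof.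
move=> tau0 C0 hTtau adm t u K t0; have [_ TmE] := hTm1.
have [n tn] : exists n : nat, t <= n.+1%:R * tau.
  by exists (Num.truncn (t / tau)); rewrite -ler_pdivrMr// ltW// truncnS_gt.
elim: n t t0 tn => [|n IHn] t t0 tn Lu uK.
  have tt : t <= tau by rewrite mul1r in tn.
  have [x xE xle] := adm t t0 tt u Lu; exists x => //.
  have uK0 := uK 0 t (lexx _) t0 (lexx _); rewrite add0r in uK0.
  apply: le_trans xle _.
  have K0 : 0 <= K by apply: le_trans (uK0 tt); exact: L1_norm_ge0.
  apply: le_trans (ler_wpM2l C0 (uK0 tt)) _.
  by rewrite -mulrA ler_peMl ?mulr_ge0// ler1n.
have [tt|/ltW tt] := leP t tau.
  apply: (IHn t) => //; apply: le_trans tt _.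
  by apply: ler_peMl; [exact: ltW|rewrite ler1n].
pose a := t - tau; have a0 : 0 <= a by rewrite subr_ge0.
have at_ : a <= t by rewrite gerBl ltW.
have ta : t - a = tau by rewrite /a subKr.
have sub1 : `]0, a[%classic `<=` `]0, t[%classic.
  by apply: subset_itvl; rewrite bnd_simp.
have sub2 : `]a, t[%classic `<=` `]0, t[%classic.
  by apply: subset_itvr; rewrite bnd_simp.
have [x1 x1E x1le] : exists2 x, iota x = Xi a u & `|x| <= 2 * C * K.
  apply: IHn => //.
  - by move: tn; rewrite /a -natr1 mulrDl mul1r lerBlDr.
  - exact: L1_mem_subset Lu.
  - by move=> a' c a'0 a'c ca; apply: uK => //; exact: le_trans ca at_.
have Lua := L1_mem_shift a0 at_ Lu; rewrite ta in Lua.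
have [x2 x2E x2le] := adm tau (ltW tau0) (lexx _) _ Lua.
exists (T tau x1 + x2).
  rewrite (input_map_split hTm1 M0 b0 hM hb a0 at_ Lu) ta -x1E -x2E.
  by rewrite linearD TmE// ltW.
have NK : L1_norm `]0, tau[ (fun s => u (s + a)) <= K.
  rewrite -ta L1_norm_shift; last exact: L1_mem_subset Lu.
  by apply: uK => //; rewrite /a subrK.
have h1 := ler_wpM2l C0 NK; have h2 := hTtau x1.
by apply: le_trans (ler_normD _ _) _; lra.
Qed.

End horizons.

(** * Young functions and Luxemburg norms *)

Section young.
Context {R : realType}.
Variables (phi Phi : R -> R).
Local Notation mu := (@lebesgue_measure R).
Hypothesis phi_nd : {in `[0, +oo[ &, {homo phi : x y / x <= y}}.
Hypothesis phi0 : phi 0 = 0.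
Hypothesis PhiE : forall t, 0 <= t -> Phi t = \int[mu]_(s in `[0, t]) phi s.

Let max0_homo (r s : R) : r <= s ->
  0 <= Num.max 0 r /\ Num.max 0 r <= Num.max 0 s.
Proof.
by move=> rs; split; rewrite ?ge_max !le_max lexx// rs orbT.
Qed.

Let phi_le (s t : R) : 0 <= s -> s <= t -> phi s <= phi t.
Proof.
by move=> s0 st; apply: phi_nd; rewrite ?in_itv/= ?andbT// (le_trans s0).
Qed.

Let phi_ge0 (s : R) : 0 <= s -> 0 <= phi s.
Proof. by move=> s0; rewrite -phi0; exact: phi_le. Qed.

Let phi_integrable (t : R) : mu.-integrable `[0, t] (EFin \o phi).
Proof.
have finI : (mu `[0%R, t] < +oo)%E.
  by rewrite lebesgue_measure_itv/= lte_fin; case: ifP => _; rewrite ?sube0 ?ltry.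
pose phi' r := phi (Num.max 0 r).
have mphi : measurable_fun `[0, t] phi.
  apply: (@eq_measurable_fun _ _ _ _ _ phi').
    by move=> r /set_mem/=; rewrite in_itv/= => /andP[r0 _]; rewrite /phi' max_r.
  apply: nondecreasing_measurable => // r s rs.
  by have [] := max0_homo rs; exact: phi_le.
apply: (@le_integrable _ _ _ mu _ _ _ (EFin \o cst (phi t))) => //.
- by apply/measurable_EFinP.
- move=> r /=; rewrite in_itv/= => /andP[r0 rt].
  rewrite lee_fin !ger0_norm ?phi_ge0 ?phi_le//.
  exact: le_trans rt.
- apply/integrableP; split; first exact/measurable_EFinP.
  by rewrite (eq_integral (cst `|phi t|%:E))// integral_cst// lte_mul_pinfty.
Qed.

(** This is convexity in the form of its slopes; the growth and scaling estimates for [Phi] are all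
    drawn from it. *)
Lemma young_secant (s t : R) : 0 <= s -> s <= t ->
  phi s * (t - s) <= Phi t - Phi s <= phi t * (t - s).
Proof.
move=> s0 st; rewrite !PhiE ?(le_trans s0)//.
rewrite (Rintegral_itvB (phi_integrable t)) ?bnd_simp//.
have mE : fine (mu `]s, t]) = t - s.
  rewrite lebesgue_measure_itv/= lte_fin; case: ltgtP st => // -> _.
  by rewrite subrr.
have finI : (mu `]s, t] < +oo)%E.
  by rewrite lebesgue_measure_itv/= lte_fin; case: ifP => _; rewrite ?ltry.
have ci (c : R) : mu.-integrable `]s, t] (EFin \o cst c).
  apply/integrableP; split; first exact/measurable_EFinP.
  by rewrite (eq_integral (cst `|c|%:E))// integral_cst// lte_mul_pinfty.
have pi : mu.-integrable `]s, t] (EFin \o phi).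
  apply: (integrableS _ _ _ (phi_integrable t)) => //.
  by apply: subset_itvr; rewrite bnd_simp.
rewrite -mE -!Rintegral_cst//; apply/andP; split; apply: le_Rintegral => //.
- exact: ci.
- by move=> r /=; rewrite in_itv/= => /andP[/ltW sr _]; exact: phi_le.
- exact: ci.
- move=> r /=; rewrite in_itv/= => /andP[/ltW sr rt].
  by apply: phi_le => //; exact: le_trans sr.
Qed.

Lemma young0 : Phi 0 = 0.
Proof. by rewrite PhiE// set_itv1 Rintegral_set1. Qed.

Lemma young_le_mul (t : R) : 0 <= t -> Phi t <= t * phi t.
Proof.
by move=> t0; have /andP[_] := young_secant (lexx 0) t0; rewrite young0 !subr0 mulrC.
Qed.

Lemma young_nondecreasing (s t : R) : 0 <= s -> s <= t -> Phi s <= Phi t.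
Proof.
move=> s0 st; have /andP[+ _] := young_secant s0 st.
have : 0 <= phi s * (t - s) by rewrite mulr_ge0 ?phi_ge0// subr_ge0.
lra.
Qed.

Lemma young_ge0 (t : R) : 0 <= t -> 0 <= Phi t.
Proof. by move=> t0; rewrite -young0; exact: young_nondecreasing. Qed.

Lemma young_linear_growth (t : R) : 0 <= t -> phi 1 * (t - 1) <= Phi t.
Proof.
move=> t0; have [t1|/ltW t1] := leP 1 t.
  have /andP[+ _] := young_secant ler01 t1; have := young_ge0 ler01; lra.
apply: le_trans (young_ge0 t0).
by rewrite mulr_ge0_le0 ?phi_ge0// subr_le0.
Qed.

(** With [t = c * s], the surplus [(c - 1) * Phi s] is at most
    [(c - 1) * s * phi s = (t - s) * phi s], which the secant bound dominates by [Phi t - Phi s]. *)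
Lemma young_scale (c t : R) : 1 <= c -> 0 <= t -> c * Phi (c^-1 * t) <= Phi t.
Proof.
move=> c1 t0; have c0 : 0 < c by exact: lt_le_trans c1.
set s := c^-1 * t; have s0 : 0 <= s by rewrite mulr_ge0// invr_ge0 ltW.
have tE : t = c * s by rewrite /s mulrA divff ?mul1r// gt_eqF.
have st : s <= t by rewrite tE ler_peMl.
have /andP[+ _] := young_secant s0 st; have := young_le_mul s0.
have -> : t - s = (c - 1) * s by rewrite {1}tE; ring.
have c10 : 0 <= c - 1 by rewrite subr_ge0.
move=> h1 h2; have := ler_wpM2l c10 h1; move: h2.
rewrite mulrCA (mulrC (phi s)); set p := (_ * _); lra.
Qed.

Section luxemburg.
Variable U : completeNormedModType R.
Implicit Types (D : set R) (u : R -> U).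

Let modular_ge0 D u k : 0 < k -> (0 <= orlicz_modular Phi D u k)%E.
Proof.
move=> k0; apply: integral_ge0 => x _; rewrite lee_fin; apply: young_ge0.
by rewrite mulr_ge0// invr_ge0 ltW.
Qed.

(** This makes the set in the Luxemburg infimum nonempty; the infimum of the empty set would be 0
    and control nothing. Enlarging [k] by the factor [1 + m], where [m] is the finite modular at
    [k], divides the modular by at least that factor. *)
Lemma modular_le1 D u : measurable D -> LPhi_mem Phi D u ->
  exists2 k, 0 < k & (orlicz_modular Phi D u k <= 1)%E.
Proof.
move=> mD [bu [k k0 fin]].
have m0 := modular_ge0 D u k0.
set m := orlicz_modular Phi D u k in fin m0.
have mE : m = (fine m)%:E by rewrite fineK// ge0_fin_numE.
pose c := 1 + fine m; have c1 : 1 <= c by rewrite lerDl fine_ge0.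
have c0 : 0 < c by exact: lt_le_trans c1.
exists (c * k); first exact: mulr_gt0.
have [g sg ug] := bochner_measurable_rep bu.
(* [Phi] is unspecified at negative arguments; freezing it there gives a function monotone on the
   whole line, hence measurable. *)
pose Psi r := Phi (Num.max 0 r).
have mPsi : measurable_fun setT Psi.
  apply: nondecreasing_measurable => // r s rs.
  by have [] := max0_homo rs; exact: young_nondecreasing.
have Psi0 r : 0 <= Psi r by apply: young_ge0; rewrite le_max lexx.
have mg : measurable_fun D (fun x => (Psi (k^-1 * `|g x|))%:E).
  apply/measurable_EFinP; apply: (measurableT_comp mPsi).
  by apply: measurable_funM => //; exact: strongly_measurable_norm.
have arg0 x : 0 <= k^-1 * `|g x| by rewrite mulr_ge0// invr_ge0 ltW.
have mgE : (\int[mu]_(x in D) (Psi (k^-1 * `|g x|)%R)%:E)%E = m.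
  apply: ge0_ae_eq_integral_nonmeasurable => [x _|x _|].
  - by rewrite lee_fin.
  - by rewrite lee_fin young_ge0// mulr_ge0// invr_ge0 ltW.
  - by apply: filterS ug => x + Dx => /(_ Dx) ->; rewrite /Psi max_r.
apply: (@le_trans _ _ (\int[mu]_(x in D) ((c^-1)%:E * (Psi (k^-1 * `|g x|)%R)%:E))%E).
  apply: ge0_ae_le_integral => [x _|x _|].
  - by rewrite lee_fin young_ge0// mulr_ge0// invr_ge0 mulr_ge0 ?ltW.
  - by apply: mule_ge0; rewrite lee_fin// invr_ge0 ltW.
  - apply: filterS ug => x + Dx => /(_ Dx) ->.
    rewrite -EFinM lee_fin /Psi max_r// -ler_pdivrMl ?invr_gt0// invrK.
    by rewrite invfM -mulrA; exact: young_scale.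
rewrite ge0_integralZl_EFin//; last 2 first.
- by move=> x _; rewrite lee_fin.
- by rewrite invr_ge0 ltW.
rewrite mgE mE -EFinM lee_fin ler_pdivrMl// mulr1 /c.
by rewrite lerDr.
Qed.

(** Put [r = |u| / k]. Then [r] is at most 1 plus the positive part of [r - 1], and that part times
    [phi 1] is at most [Phi r]; integrate over [E]. *)
Lemma eL1_norm_modular D u k : bochner_measurable D u ->
  0 < phi 1 -> 0 < k -> (orlicz_modular Phi D u k <= 1)%E ->
  forall E, measurable E -> E `<=` D ->
  (eL1_norm E u <= k%:E * (mu E + (phi 1)^-1%:E))%E.
Proof.
move=> bu p0 k0 mod1 E mE ED.
have [g sg ug] := bochner_measurable_rep (bochner_measurable_subset ED bu).
have k0' : 0 <= k^-1 by rewrite invr_ge0 ltW.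
pose h x := Num.max 0 (k^-1 * `|g x| - 1).
have h0 x : 0 <= h x by rewrite /h le_max lexx.
have mh : measurable_fun E (fun x => (h x)%:E).
  apply/measurable_EFinP; apply: measurable_maxr => //.
  apply: measurable_funB => //; apply: measurable_funM => //.
  exact: strongly_measurable_norm.
have hmod : (\int[mu]_(x in E) (h x)%:E <= (phi 1)^-1%:E)%E.
  have : ((phi 1)%:E * \int[mu]_(x in E) (h x)%:E <= 1)%E.
    rewrite -ge0_integralZl_EFin//; last 2 first.
    - by move=> x _; rewrite lee_fin.
    - exact: ltW.
    apply: le_trans mod1.
    apply: (@le_trans _ _ (orlicz_modular Phi E u k)).
      apply: ge0_ae_le_integral => [x _|x _|].
      - by rewrite mule_ge0 ?lee_fin ?h0// ltW.
      - by rewrite lee_fin young_ge0// mulr_ge0.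
      - apply: filterS ug => x + Ex => /(_ Ex) ->.
        rewrite -EFinM lee_fin /h; case: (leP 0 (k^-1 * `|g x| - 1)) => _.
          by apply: young_linear_growth; rewrite mulr_ge0.
        by rewrite mulr0 young_ge0// mulr_ge0.
    by apply: ge0_integral_subset => // x _; rewrite lee_fin young_ge0// mulr_ge0.
  by rewrite -lee_pdivlMl// mule1.
rewrite (eL1_norm_ae ug).
apply: (@le_trans _ _ (\int[mu]_(x in E) (k%:E * (1 + (h x)%:E)))%E).
  apply: ge0_ae_le_integral => // [x _|].
    by apply: mule_ge0; rewrite -?EFinD lee_fin ?addr_ge0// ltW.
  apply: nearW => x _; rewrite -EFinD -EFinM lee_fin.
  rewrite -ler_pdivrMl// /h; case: (leP 0 (k^-1 * `|g x| - 1)); lra.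
rewrite ge0_integralZl_EFin//; last 3 first.
- by move=> x _; rewrite -EFinD lee_fin addr_ge0.
- exact: emeasurable_funD.
- exact: ltW.
rewrite ge0_integralD//; last first.
  by move=> x _; rewrite lee_fin.
rewrite integral_cst// mul1e lee_pmul2l ?fin_numE ?lte_fin//.
exact: leeD2l.
Qed.

End luxemburg.

End young.

(** * A Young function growing slowly along prescribed bounds *)

Section slow_young_function.
Context {R : realType}.
Variable m : nat -> R.
Local Notation mu := (@lebesgue_measure R).

(** Constant [n.+1] up to [m n], then of slope one. The infimum over [n] is at least 1, and the
    minimum with [s] in [slow_derivative] forces the value 0 at 0. *)
Let hat (n : nat) (s : R) : R := n.+1%:R + Num.max 0 (s - m n).

(* A 1-Lipschitz function tending to infinity and bounded by [n.+1] at [m n]. *)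
Definition slow_derivative (s : R) : R :=
  Num.min s (inf (range (hat ^~ s))).

Definition slow_young (t : R) : R := \int[mu]_(s in `[0, t]) slow_derivative s.

Let hat_ge (n : nat) s : n.+1%:R <= hat n s.
Proof. by rewrite /hat lerDl le_max lexx. Qed.

Let hat_lb s (c : R) : (forall n, c <= hat n s) -> c <= inf (range (hat ^~ s)).
Proof.
move=> h; apply: lb_le_inf; first by exists (hat 0%N s), 0%N.
by move=> _ [n _ <-].
Qed.

Let inf_le s n : inf (range (hat ^~ s)) <= hat n s.
Proof.
apply: ge_inf; last by exists n.
by exists 0 => _ [k _ <-]; exact: le_trans (hat_ge k s).
Qed.

Let slow_lipschitz s t : s <= t ->
  slow_derivative s <= slow_derivative t <= slow_derivative s + (t - s).
Proof.
move=> st; rewrite /slow_derivative; apply/andP; split.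
  rewrite le_min; apply/andP; split; first by rewrite ge_min st.
  rewrite ge_min; apply/orP; right; apply: hat_lb => n; apply: le_trans (inf_le s n) _.
  rewrite /hat lerD2l; case: (leP 0 (s - m n)); case: (leP 0 (t - m n)); lra.
have : inf (range (hat ^~ t)) <= inf (range (hat ^~ s)) + (t - s).
  rewrite -lerBlDr; apply: hat_lb => n; have := inf_le t n.
  rewrite /hat; case: (leP 0 (s - m n)); case: (leP 0 (t - m n)); lra.
set a := inf _; set b := inf _; move=> ab; rewrite /Num.min.
by case: ifPn; case: ifPn; rewrite -?leNgt; lra.
Qed.

Lemma slow_young_young : young_function slow_young.
Proof.
exists slow_derivative; split.
- move=> s _; apply/cvgrPdist_lt => e e0.
  near=> t.
  have st : s <= t by near: t; exact: nbhs_right_ge.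
  have te : t < s + e by near: t; apply: nbhs_right_lt; rewrite ltrDl.
  have /andP[h1 h2] := slow_lipschitz st.
  by rewrite distrC ger0_norm ?subr_ge0//; lra.
- by move=> s t _ _ st; have /andP[] := slow_lipschitz st.
- have inf1 s : 1 <= inf (range (hat ^~ s)).
    by apply: hat_lb => n; apply: le_trans (hat_ge n s); rewrite ler1n.
  split => [|s s0]; last by rewrite lt_min s0 (lt_le_trans ltr01).
  by rewrite /slow_derivative min_l// (le_trans _ (inf1 0)).
- apply/cvgryPge => c; pose N := (Num.truncn c).+1.
  have cN : c <= N%:R by exact/ltW/truncnS_gt.
  near=> s.
  (* Beyond this point the finitely many hats of index below [N] have risen above [N]; the others
     start above [N] already. *)
  have sN : N%:R + \sum_(i < N) `|m i| <= s.
    by near: s; apply: nbhs_pinfty_ge; rewrite num_real.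
  apply: le_trans cN _; rewrite le_min; apply/andP; split.
    by apply: le_trans sN; rewrite lerDl sumr_ge0.
  apply: hat_lb => n; have [nN|Nn] := ltnP n N; last first.
    by apply: le_trans (hat_ge n s); rewrite ler_nat leqW.
  have mi : m n <= \sum_(i < N) `|m i|.
    apply: le_trans (ler_norm _) _.
    by rewrite (bigD1 (Ordinal nN))//= lerDl sumr_ge0.
  have : N%:R <= s - m n by lra.
  move=> h; apply: le_trans h _; rewrite /hat.
  apply: (@le_trans _ _ (Num.max 0 (s - m n))); first by rewrite le_max lexx orbT.
  by rewrite lerDr.
- by [].
Unshelve. all: by end_near. Qed.

Lemma slow_derivative_le n : slow_derivative (m n) <= n.+1%:R.
Proof.
rewrite /slow_derivative ge_min; apply/orP; right.
by apply: le_trans (inf_le _ n) _; rewrite /hat subrr max_l// addr0.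
Qed.

Lemma slow_young_le n (s : R) : 0 <= s -> s <= m n -> slow_young s <= n.+1%:R * s.
Proof.
move=> s0 sm; have [phi0 nd] : slow_derivative 0 = 0 /\
    {in `[0, +oo[ &, {homo slow_derivative : x y / x <= y}}.
  have inf1 : 1 <= inf (range (hat ^~ 0)).
    by apply: hat_lb => k; apply: le_trans (hat_ge k 0); rewrite ler1n.
  split; first by rewrite /slow_derivative min_l// (le_trans _ inf1).
  by move=> x y _ _ xy; have /andP[] := slow_lipschitz xy.
apply: le_trans (young_le_mul nd phi0 (fun _ _ => erefl) s0) _.
rewrite mulrC ler_wpM2r//; apply: le_trans (slow_derivative_le n).
by have /andP[] := slow_lipschitz sm.
Qed.

End slow_young_function.

(** * The equivalences *)

Section comparison.
Context {R : realType}.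

Lemma class_K_homo (mu : R -> R) (r s : R) : class_K mu -> 0 <= r -> r <= s -> mu r <= mu s.
Proof.
move=> [_ _ mono _] r0; rewrite le_eqVlt => /predU1P[->//|rs].
by apply/ltW/mono => //; rewrite in_itv/= andbT// (le_trans r0)// ltW.
Qed.

Lemma linear_class_Kinfty (c : R) : 0 < c -> class_Kinfty (fun r => c * r).
Proof.
move=> c0; split; last first.
  by apply/gt0_cvgMry.
split=> [x x0||x y _ _ xy|]; last by rewrite mulr0.
- by rewrite mulr_ge0// ltW.
- by apply: continuous_subspaceT => x; exact: mulrl_continuous.
- by rewrite ltr_pM2l.
Qed.

Lemma class_KL_halving (beta : R -> R -> R) : class_KL beta ->
  [/\ 0 <= beta 1 0, forall t, 0 <= t -> beta 1 t <= beta 1 0 &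
      exists2 t, 0 < t & beta 1 t <= 2^-1].
Proof.
move=> [_ /(_ 1 ltr01)[b0 _ bdec blim]]; split; first exact: b0.
- move=> t; rewrite le_eqVlt => /predU1P[<-//|t0].
  by apply/ltW/bdec => //; rewrite in_itv/= ?lexx// ltW.
- have h : (0 : R) < 2^-1 by rewrite invr_gt0.
  near (pinfty_nbhs R) => t; exists t.
    by near: t; apply: nbhs_pinfty_gt; rewrite num_real.
  apply: le_trans (ler_norm _) _; rewrite -[X in `|X|]subr0 distrC; apply: ltW.
  by near: t; move/cvgrPdist_lt: blim; apply.
Unshelve. all: by end_near. Qed.

(** Evaluating at unit vectors replaces the nonlinear bound, such as a KL function of the initial
    state, by a linear one. *)
Lemma homogeneous_bound (X : normedModType R) (L : {linear X -> X}) (g : R -> R) :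
  (forall x, `|L x| <= g `|x|) -> forall x, `|L x| <= g 1 * `|x|.
Proof.
move=> hL x; have [->|x0] := eqVneq x 0; first by rewrite linear0 !normr0 mulr0.
have nx : 0 < `|x| by rewrite normr_gt0.
have := hL (`|x|^-1 *: x).
rewrite linearZZ !normrZ normfV normr_id mulVf ?gt_eqF//.
by rewrite mulrC ler_pdivrMr.
Qed.

End comparison.

Section simple_orlicz.
Context {R : realType} (U : completeNormedModType R).
Variables (Phi : R -> R) (D : set R).
Local Notation mu := (@lebesgue_measure R).
Hypotheses (hPhi : young_function Phi) (mD : measurable D) (finD : (mu D < +oo)%E).

Lemma luxemburg_norm_ge0 (u : R -> U) : 0 <= luxemburg_norm Phi D u.
Proof.
rewrite /luxemburg_norm; set S := [set _ | _].
have [->|/set0P S0] := eqVneq S set0; first by rewrite inf0.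
by apply: lb_le_inf => // k [/ltW].
Qed.

Lemma luxemburg_norm_le (u : R -> U) (k : R) : 0 < k ->
  (orlicz_modular Phi D u k <= 1)%E -> luxemburg_norm Phi D u <= k.
Proof.
move=> k0 km; apply: ge_inf => //.
by exists 0 => c [/ltW].
Qed.

Lemma luxemburg_norm_eq0 (u : R -> U) : (forall x, D x -> u x = 0) ->
  luxemburg_norm Phi D u = 0.
Proof.
move=> u0; have [phi [_ _ _ _ PhiE]] := hPhi.
apply/eqP; rewrite eq_le luxemburg_norm_ge0 andbT; apply/ler_addgt0Pr => e e0.
rewrite add0r; apply: luxemburg_norm_le => //.
rewrite /orlicz_modular integral0_eq ?lee01// => x Dx.
by rewrite u0// normr0 mulr0 (young0 PhiE).
Qed.

Lemma EPhi_mem_simple (s : R -> U) : simple_fun s -> EPhi_mem Phi D s.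
Proof.
move=> ss; have [phi [_ nd [phi0 _] _ PhiE]] := hPhi.
have bs : bochner_measurable D s by exact: simple_bochner_measurable.
have [M M0 sM] := simple_fun_bounded ss.
split; first split => //.
  exists 1 => //; apply: (@le_lt_trans _ _ (\int[mu]_(x in D) (cst (Phi M)%:E) x)%E).
    apply: ge0_ae_le_integral => [x _|x _|].
    - by rewrite lee_fin (young_ge0 nd phi0 PhiE)// invr1 mul1r.
    - by rewrite lee_fin (young_ge0 nd phi0 PhiE).
    - apply: nearW => x _; rewrite lee_fin invr1 mul1r.
      exact: (young_nondecreasing nd phi0 PhiE).
  rewrite integral_cst// lte_mul_pinfty// lee_fin.
  exact: (young_ge0 nd phi0 PhiE).
move=> e e0; exists s; first by split => //; exists M; apply: nearW.
by rewrite luxemburg_norm_eq0// => x _ /=; rewrite subrr.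
Qed.

Lemma luxemburg_L1 (phi : R -> R) (u : R -> U) :
  {in `[0, +oo[ &, {homo phi : x y / x <= y}} -> phi 0 = 0 -> 0 < phi 1 ->
  (forall t, 0 <= t -> Phi t = \int[mu]_(s in `[0, t]) phi s) ->
  LPhi_mem Phi D u ->
  L1_mem D u /\ forall E c, measurable E -> E `<=` D -> (mu E <= c%:E)%E ->
    L1_norm E u <= (c + (phi 1)^-1) * luxemburg_norm Phi D u.
Proof.
move=> nd phi0 phi1 PhiE LPhi; have [bu _] := LPhi.
have [k k0 kmod] := modular_le1 nd phi0 PhiE mD LPhi.
have bound := eL1_norm_modular nd phi0 PhiE bu phi1.
have Lu : L1_mem D u.
  split => //; apply: le_lt_trans (bound k k0 kmod D mD (@subset_refl _ _)) _.
  by rewrite lte_mul_pinfty ?lee_fin ?ltW// lte_add_pinfty// ltry.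
split => // E c mE ED Ec.
have LE := L1_mem_subset ED Lu.
have c0 : 0 <= c by rewrite -lee_fin; apply: le_trans Ec.
have cp : 0 < c + (phi 1)^-1 by rewrite ltr_wpDl// invr_gt0.
rewrite mulrC -ler_pdivrMr//; apply: lb_le_inf; first by exists k.
move=> l [l0 lmod]; rewrite ler_pdivrMr// -lee_fin -eL1_normE//.
apply: le_trans (bound l l0 lmod E mE ED) _.
by rewrite EFinM lee_pmul2l ?lte_fin// EFinD leeD2r.
Qed.

End simple_orlicz.

Section characterization.
Context {R : realType} {X U Y : completeNormedModType R}.
Variables (A : operator X) (T : R -> {linear X -> X}).
Variables (iota : {linear X -> Y}) (Tm1 : R -> {linear Y -> Y}).
Variables (B : {linear U -> Y}).
Hypotheses (hT : C0_semigroup T) (hA : generates A T).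
Hypotheses (hY : extrapolation_space A iota) (hTm1 : extended_semigroup iota T Tm1).
Hypothesis hB : continuous B.
Local Notation mu := (@lebesgue_measure R).
Local Notation Xi := (input_map Tm1 B).

Lemma mild_solution_zero_input (x0 : X) (t : R) :
  mild_solution iota T Tm1 B x0 (fun _ => 0) t = iota (T t x0).
Proof.
rewrite /mild_solution (_ : bochner_integral _ _ = 0) ?addr0//.
rewrite (@bochner_integral_eq _ _ _ _ (fun _ => 0)); last by move=> s _; rewrite !linear0.
apply/eqP; rewrite -normr_le0 -lee_fin.
apply: le_trans (ler_norm_bochner_integral (measurable_itv _)
  (lebesgue_measure_itv_lty 0 t) (L1_mem0 _ _)) _.
by rewrite /eL1_norm integral0_eq// => s _; rewrite normr0.
Qed.

Lemma mild_solution_zero_state (u : R -> U) (t : R) :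
  mild_solution iota T Tm1 B 0 u t = Xi t u.
Proof. by rewrite /mild_solution linear0 linear0 add0r. Qed.

Lemma zero_input_bound (beta : R -> R -> R) :
  (forall t x0, 0 <= t ->
    exists2 x, iota x = mild_solution iota T Tm1 B x0 (fun _ => 0) t & `|x| <= beta `|x0| t) ->
  forall t x, 0 <= t -> `|T t x| <= beta `|x| t.
Proof.
move=> h t x t0; have [y + yle] := h t x t0.
by rewrite mild_solution_zero_input => /(extrapolation_injective hA hY) <-.
Qed.

Lemma linear_gain_ISS (Z : input_space U) (beta : R -> R -> R) (C : R) :
  class_KL beta -> (forall t x, 0 <= t -> `|T t x| <= beta `|x| t) -> 0 <= C ->
  (forall t u, 0 <= t -> in_space Z t u -> 0 <= space_norm Z t u /\
    exists2 x, iota x = Xi t u & `|x| <= C * space_norm Z t u) ->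
  ISS iota T Tm1 B Z.
Proof.
(* [C] may be 0, whereas a gain of class K-infinity needs a positive slope. *)
move=> KLb hb C0 hZ; exists beta, (fun r => (C + 1) * r); split => //.
  by apply: linear_class_Kinfty; rewrite ltr_wpDl.
move=> t x0 u t0 Zu; have [n0 [x xE xle]] := hZ t u t0 Zu.
exists (T t x0 + x); first by rewrite linearD xE.
apply: le_trans (ler_normD _ _) _; apply: lerD; first exact: hb.
by apply: le_trans xle _; rewrite mulrDl lerDl mul1r.
Qed.

Section growth.
Variable beta : R -> R -> R.
Hypothesis KLb : class_KL beta.
Hypothesis Tb : forall t x, 0 <= t -> `|T t x| <= beta `|x| t.

Lemma semigroup_bound (t : R) (x : X) : 0 <= t -> `|T t x| <= beta 1 t * `|x|.
Proof.
move=> t0; apply: (@homogeneous_bound _ _ _ (fun r => beta r t)) => y; exact: Tb.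
Qed.

Lemma extrapolated_bound (t : R) (y : Y) : 0 <= t -> `|Tm1 t y| <= beta 1 0 * `|y|.
Proof.
have [b0 bdec _] := class_KL_halving KLb.
move=> t0; apply: (extended_semigroup_bound hT hA hY hTm1 t0 b0) => x.
by apply: le_trans (semigroup_bound x t0) _; rewrite ler_wpM2r// bdec.
Qed.

End growth.

Lemma L1_ISS_iISS : ISS iota T Tm1 B (L1_space U) -> iISS iota T Tm1 B (L1_space U).
Proof.
move=> [beta [theta [KLb Kth iss]]].
exists beta, theta, (fun r => 1 * r); split => //.
  by have [] := linear_class_Kinfty (ltr01 : (0 : R) < 1).
move=> t x0 u t0 Lu /=; have [x xE xle] := iss t x0 u t0 Lu; exists x => // _.
by under eq_integral do rewrite mul1r.
Qed.

Lemma iISS_EPhi_ISS (Phi : R -> R) : young_function Phi ->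
  iISS iota T Tm1 B (L1_space U) -> ISS iota T Tm1 B (EPhi_space U Phi).
Proof.
move=> yPhi [beta [theta [g [KLb [[_ _ _ th0] _] [_ _ _ g0] iss]]]].
have Tb : forall t x, 0 <= t -> `|T t x| <= beta `|x| t.
  apply: zero_input_bound => t x0 t0.
  have [x xE xle] := iss t x0 (fun _ => 0) t0 (L1_mem0 _ _).
  exists x => //; move: xle; rewrite integral0_eq ?ltry//= ?th0 ?addr0.
    exact.
  by move=> s _; rewrite normr0 g0.
have [M0 _ [tau tau0 half]] := class_KL_halving KLb.
have hM := extrapolated_bound KLb Tb.
have [b b0 hb] := continuous_linear_bound hB.
(* The estimate that comes with the state is discarded, as its integral may be infinite;
   [admissible_simple] supplies the bound instead. *)
have reach u : L1_mem `]0, tau[ u -> exists x, iota x = Xi tau u.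
  move=> Lu; have [x] := iss tau 0 u (ltW tau0) Lu.
  by rewrite mild_solution_zero_state; exists x.
have [C C0 adm] := admissible_simple hT hA hY hTm1 M0 b0 hM hb reach.
have admt t : 0 <= t -> t <= tau -> admissible_on iota Tm1 B t C (L1_mem `]0, t[).
  move=> t0 tt; apply: (admissible_simple_L1 hA hY hTm1 M0 b0 hM hb C0).
  exact: (admissible_simple_le hTm1 M0 b0 hM hb t0 tt).
have halfT x : `|T tau x| <= 2^-1 * `|x|.
  by apply: le_trans (semigroup_bound Tb x (ltW tau0)) _; rewrite ler_wpM2r.
have [phi [_ nd [phi0 phigt] _ PhiE]] := yPhi.
have p1 := phigt 1 ltr01.
(* [2 * C] is the gain over all times per window, and the other factor compares the L^1-norm on a
   window of length at most [tau] with the Luxemburg norm on the whole interval. *)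
have Cp : 0 <= 2 * C * (tau + (phi 1)^-1).
  by rewrite !mulr_ge0// addr_ge0 ?invr_ge0// ltW.
apply: (linear_gain_ISS KLb Tb Cp) => t u t0 [LPhi _].
split; first exact: luxemburg_norm_ge0.
have [Lu bound] := luxemburg_L1 (measurable_itv _) (lebesgue_measure_itv_lty 0 t)
  nd phi0 p1 PhiE LPhi.
rewrite -(mulrA (2 * C)).
apply: (admissible_infinite_time hTm1 M0 b0 hM hb tau0 C0 halfT admt t0 Lu).
move=> a c a0 ac ct catau; apply: bound => //.
- apply: subset_itv; rewrite bnd_simp//.
- rewrite lebesgue_measure_itv/= lte_fin; case: ifPn => _; last by rewrite lee_fin ltW.
  by rewrite -EFinD lee_fin lerBlDl.
Qed.

Lemma EPhi_ISS_L1_ISS :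
  (forall Phi, young_function Phi -> ISS iota T Tm1 B (EPhi_space U Phi)) ->
  ISS iota T Tm1 B (L1_space U).
Proof.
move=> iss.
have mI t : measurable (`]0%R, t[%classic : set R) by exact: measurable_itv.
have fI t := lebesgue_measure_itv_lty (0 : R) t.
have Ls t (s : R -> U) : simple_fun s -> L1_mem `]0, t[ s by exact: L1_mem_simple.
(* Any one Young function yields the semigroup bound and the reachability of simple inputs; the
   decisive one can only be built once the bad inputs are known. *)
have y0 := slow_young_young (fun _ : nat => (0 : R)).
have [beta [g [KLb [[_ _ _ g0] _] issb]]] := iss _ y0.
have Es t (s : R -> U) Phi : young_function Phi -> simple_fun s -> EPhi_mem Phi `]0, t[ s.
  by move=> yPhi; apply: EPhi_mem_simple => //; exact: fI.
have Tb : forall t x, 0 <= t -> `|T t x| <= beta `|x| t.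
  apply: zero_input_bound => t x0 t0.
  have [x xE xle] := issb t x0 (fun _ => 0) t0 (Es _ _ _ y0 (simple_fun_cst 0)).
  by exists x => //; move: xle; rewrite /= (luxemburg_norm_eq0 y0)// g0 addr0.
have [M0 _ _] := class_KL_halving KLb.
have hM := extrapolated_bound KLb Tb.
have [b b0 hb] := continuous_linear_bound hB.
have [[C [C0 adm]]|nadm] := pselect (exists C, 0 <= C /\
    forall t, 0 <= t -> admissible_on iota Tm1 B t C (@simple_fun R U)).
  apply: (linear_gain_ISS KLb Tb C0) => t u t0 Lu; split; first exact: L1_norm_ge0.
  exact: (admissible_simple_L1 hA hY hTm1 M0 b0 hM hb C0 (adm t t0)).
exfalso.
have /choice[w hw] (n : nat) : exists w : R * (R -> U) * X,
    [/\ 0 <= w.1.1, simple_fun w.1.2, iota w.2 = Xi w.1.1 w.1.2, `|w.2| = n.+1%:R &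
        n.+1%:R * L1_norm `]0, w.1.1[ w.1.2 <= 1].
  (* The square leaves one factor [n.+1] for the norm of the rescaled state and one for the
     smallness of the L^1-norm of the rescaled input. *)
  pose c : R := n.+1%:R * n.+1%:R.
  have [t [s [x [t0 ss xE xgt]]]] : exists t s x,
      [/\ 0 <= t, simple_fun s, iota x = Xi t s & c * L1_norm `]0, t[ s < `|x| ].
    apply: contrapT => h; apply: nadm; exists c; split; first by rewrite mulr_ge0.
    move=> t t0 s ss; have [x] := issb t 0 s t0 (Es _ _ _ y0 ss).
    rewrite mild_solution_zero_state => xE _; exists x => //.
    by rewrite leNgt; apply/negP => xlt; apply: h; exists t, s, x.
  have x0 : 0 < `|x|.
    by apply: le_lt_trans xgt; rewrite mulr_ge0 ?mulr_ge0//; exact: L1_norm_ge0.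
  pose a := n.+1%:R / `|x|; have a0 : 0 < a by rewrite divr_gt0.
  exists ((t, fun r => a *: s r), a *: x); split.
  - exact: t0.
  - have := simple_fun_lin a ss (simple_fun_cst 0).
    by congr simple_fun; apply/funext => r; rewrite addr0.
  - by rewrite /= linearZZ xE (input_mapZ hTm1 M0 b0 hM hb a (Ls _ _ ss)).
  - by rewrite /= normrZ gtr0_norm// divfK// gt_eqF.
  - rewrite /= (L1_normZ (mI t) a (Ls _ _ ss)) gtr0_norm// /a mulrA mulrA -/c mulrAC.
    by rewrite ler_pdivrMr// mul1r ltW.
have /choice[m hm] (n : nat) : exists m : R, forall r, `|(w n).1.2 r| <= m.
  by have [_ /simple_fun_bounded[m _ hm] _ _ _] := hw n; exists m.
have ym := slow_young_young m.
have [phi [_ nd [phi0 _] _ PhiE]] := ym.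
have [beta' [g' [[Kb _] [Kg _] iss']]] := iss _ ym.
(* All these inputs have Luxemburg norm at most 1 for the function adapted to [m], and the term in
   [beta'] vanishes from the zero state; a single value of the gain then bounds every [n.+1]. *)
have le_g n : n.+1%:R <= g' 1.
  have [t0 ss xE xn sle] := hw n.
  have [x] := iss' _ 0 _ t0 (Es (w n).1.1 _ _ ym ss).
  rewrite mild_solution_zero_state -xE => /(extrapolation_injective hA hY) ->.
  rewrite xn normr0 /=; have [_ _ _ ->] := Kb _ t0; rewrite add0r => h.
  apply: le_trans h _; apply: class_K_homo Kg _ _; first exact: luxemburg_norm_ge0.
  apply: luxemburg_norm_le => //.
  (* The input stays below [m n], where the Young function is at most [n.+1] times the identity, so
     its modular at [k = 1] is at most [n.+1] times its L^1-norm, that is at most 1. *)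
  apply: (@le_trans _ _ (\int[mu]_(r in `]0%R, (w n).1.1[) (n.+1%:R * `|(w n).1.2 r|)%:E)%E).
    apply: ge0_ae_le_integral => [r _|r _|].
    - by rewrite lee_fin (young_ge0 nd phi0 PhiE)// invr1 mul1r.
    - by rewrite lee_fin mulr_ge0.
    - apply: nearW => r _; rewrite lee_fin invr1 mul1r.
      exact: slow_young_le.
  rewrite (_ : (\int[_]_(_ in _) _)%E =
      eL1_norm `]0%R, (w n).1.1[ (fun r => n.+1%:R *: (w n).1.2 r)).
    have Lw := Ls (w n).1.1 _ ss.
    by rewrite (eL1_normE (L1_memZ (mI _) _ Lw)) (L1_normZ (mI _) _ Lw) lee_fin ger0_norm.
  by apply: eq_integral => r _; rewrite normrZ ger0_norm.
have := le_g (Num.truncn (g' 1)); rewrite leNgt => /negP; apply.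
exact: truncnS_gt.
Qed.

End characterization.

Theorem theorem3p4 (R : realType) (X U Xm1 : completeNormedModType R)
    (A : operator X) (T : R -> {linear X -> X})
    (iota : {linear X -> Xm1}) (Tm1 : R -> {linear Xm1 -> Xm1})
    (B : {linear U -> Xm1})
    (hT : C0_semigroup T) (hA : generates A T)
    (hXm1 : extrapolation_space A iota)
    (hTm1 : extended_semigroup iota T Tm1)
    (hB : continuous B) :
  [<-> ISS iota T Tm1 B (L1_space U);
       iISS iota T Tm1 B (L1_space U);
       forall Phi : R -> R, young_function Phi ->
         ISS iota T Tm1 B (EPhi_space U Phi)].
Proof.
tfae.
- exact: L1_ISS_iISS.
- by move=> iss Phi yPhi; exact: (iISS_EPhi_ISS hT hA hXm1 hTm1 hB yPhi iss).
- exact: (EPhi_ISS_L1_ISS hT hA hXm1 hTm1 hB).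
Qed.
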